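(* Let $A=(a_1,\dots,a_n)$ be positive integers with $a_1\le\dots\le a_n=k+1$, and let $d_j=\#\{i:a_i=j\}$, $j=1,\dots,k+1$. For $l$ with $d_l\ne0$ let $$u=(e_{d_1}\otimes e_{d_1+d_2}\otimes\cdots\otimes e_{d_1+\cdots+d_{l-1}}\otimes\mathrm{Id}\otimes\cdots\otimes\mathrm{Id})\,v_A\in F^{\otimes k}.$$ a) Let $d_l\ge2$. Let $A'\in\mathbb N^{n-2}$ be such that its associated multiplicities are $d'_l=d_l-2$ and $d'_i=d_i$ for $i\ne l$. Then the ring isomorphism $\mathbb C[e_2,\dots,e_{n-1}]\to\mathbb C[e_0,\dots,e_{n-3}]$, $e_i\mapsto e_{i-2}$, induces an isomorphism $$\mathbb C[e_2,\dots,e_{n-1}]\,u\cong W^{A'}=\mathbb C[e_0,\dots,e_{n-3}]/J^{A'}$$ sending $u$ to the class of $1$. b) Let $d_l=1$, $l=\min\{m:d_m\neq0\}$, $l\ne k+1$, and let $l_1=\min\{m>l:d_m\ne0\}$. Let $A'\in\mathbb N^{n-1}$ be such that its associated multiplicities $d'_i$ are obtained from $(d_i)$ by decreasing $d_l$ by $1$, decreasing $d_{l_1}$ by $1$ and increasing $d_{l_1-l+1}$ by $1$. Then the ring isomorphism $\mathbb C[e_1,\dots,e_{n-1}]\to\mathbb C[e_0,\dots,e_{n-2}]$, $e_i\mapsto e_{i-1}$, induces an isomorphism $$\mathbb C[e_1,\dots,e_{n-1}]\,u\cong W^{A'}=\mathbb C[e_0,\dots,e_{n-2}]/J^{A'}$$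 sending $u$ to the class of $1$.
   Context: For a tuple $A=(a_1,\dots,a_n)$ of positive integers (order irrelevant), let $e^{(n)}(z)=\sum_{i=0}^{n-1}e_iz^i$, $s_+=\max(s,0)$, and let $W^A=\mathbb C[e_0,\dots,e_{n-1}]/J^A$, where $J^A$ is generated by the coefficients of $z^m$, $0\le m<\sum_{j=1}^n(i+1-a_j)_+$, in $e^{(n)}(z)^i$, $i\ge1$ (so that $e^{(n)}(z)^i$ is divisible by $z^{\sum_j(i+1-a_j)_+}$ in $W^A$). The multiplicities associated with $A$ are $d_j=\#\{i:a_i=j\}$. The space $F$: let $\psi(i),\phi(i)$, $i\in\mathbb Z$, be mutually anticommuting variables with zero squares. $F$ is the complex vector space with basis the semi-infinite monomials $\dots\psi(N-1)\phi(N-1)\psi(N)\phi(N)\,\psi(i_1)\cdots\psi(i_s)\,\phi(j_1)\cdots\phi(j_t)$, $N<i_1<\dots<i_s$, $N<j_1<\dots<j_t$. $\psi(i),\phi(i)$ act by (right) multiplication, and $e_m=\sum_{i+j=m}\psi(i)\phi(j)$, $m\in\mathbb Z$ (commuting operators). On $F^{\otimes k}$ each $e_m$ acts by the coproduct $\sum_r\mathrm{Id}^{\otimes(r-1)}\otimes e_m\otimes\mathrm{Id}^{\otimes(k-r)}$. Put $v(2N)=\dots\psi(N-1)\phi(N-1)\psi(N)$, $v(2N+1)=\dots\psi(N-1)\phi(N-1)\psi(N)\phi(N)$ and $$v_A=v(-1+d_1)\otimes v(-1+d_1+d_2)\otimes\cdots\otimes v(-1+d_1+\cdots+d_k)\in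 F^{\otimes k}.$$ In the definition of $u$ the tensor product of operators acts factorwise (the $j$-th factor by $e_{d_1+\cdots+d_j}$ for $j\le l-1$ and by the identity for $j\ge l$). *)

(* Defs.v *)
From HB Require Import structures.
From mathcomp Require Import all_boot all_order all_algebra.
From mathcomp Require Import finmap ring_quotient ssrcomplements freeg mpoly.
From mathcomp Require Import boolp classical_sets functions cardinality fsbigop.
From mathcomp Require Import reals complex zify.

Set Implicit Arguments.
Unset Strict Implicit.
Unset Printing Implicit Defensive.

Import Order.TTheory GRing.Theory Num.Theory.

Local Open Scope quotient_scope.
Local Open Scope classical_set_scope.
Local Open Scope ring_scope.

(** * The rings W^A *)

Section W.
Variables (R : realType) (n : nat) (A : n.-tuple nat).

(* The variable e_i is 'X_i, for i : 'I_n. *)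
Definition e_poly : {poly {mpoly R[i][n]}} := \sum_(i < n) 'X_i *: 'X^i.

(* \sum_j (i + 1 - a_j)_+ ; the truncated subtraction on nat is the positive
   part. *)
Definition vanishing_order (i : nat) : nat := (\sum_(j < n) (i.+1 - tnth A j))%N.

(* x = (i, m) stands for the generator "coefficient of z^m in e(z)^i". *)
Definition J_index (x : nat * nat) : bool :=
  ((1 <= x.1) && (x.2 < vanishing_order x.1))%N.

Definition J_gen (x : nat * nat) : {mpoly R[i][n]} := (e_poly ^+ x.1)`_x.2.

Definition J : {pred {mpoly R[i][n]}} := fun P =>
  `[< exists2 s : seq ({mpoly R[i][n]} * (nat * nat)),
        all J_index [seq x.2 | x <- s] &
        P = \sum_(x <- s) x.1 * J_gen x.2 >].

Lemma J_gen_meval0 x : J_index x -> (J_gen x).@[fun=> 0] = 0.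
Proof.
case: x => -[//|i] m _; rewrite /J_gen -coef_map rmorphXn /= rmorph_sum /=.
rewrite big1 ?expr0n ?coef0// => j _.
by rewrite map_polyZ/= mevalXU scale0r.
Qed.

Lemma J_idealr_closed : idealr_closed J.
Proof.
split.
- by apply/asboolP; exists [::]; rewrite ?big_nil.
- apply/negP => /asboolP[s /allP sJ /(congr1 (meval (fun=> 0)))].
  rewrite rmorph1 rmorph_sum /= big_seq big1 => [/eqP|x xs].
    by rewrite oner_eq0.
  by rewrite rmorphM /= J_gen_meval0 ?mulr0// sJ// map_f.
- move=> a P Q /asboolP[s sJ ->] /asboolP[t tJ ->]; apply/asboolP.
  exists ([seq (a * x.1, x.2) | x <- s] ++ t).
    by rewrite map_cat all_cat tJ andbT -map_comp.
  rewrite big_cat big_map mulr_sumr; congr (_ + _).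
  by apply: eq_bigr => x _; rewrite mulrA.
Qed.

HB.instance Definition _ := isIdealr.Build {mpoly R[i][n]} J J_idealr_closed.

Definition W := {ideal_quot J}.

HB.instance Definition _ := GRing.ComNzRing.on W.

Definition W_class (P : {mpoly R[i][n]}) : W := \pi_({ideal_quot J}) P.

Lemma W_class_is_zmod_morphism : zmod_morphism W_class.
Proof. exact: raddfB. Qed.

HB.instance Definition _ :=
  GRing.isZmodMorphism.Build {mpoly R[i][n]} W W_class W_class_is_zmod_morphism.

Lemma W_class_is_monoid_morphism : monoid_morphism W_class.
Proof. by split; [exact: rmorph1 | exact: rmorphM]. Qed.

HB.instance Definition _ :=
  GRing.isMonoidMorphism.Build {mpoly R[i][n]} W W_class
    W_class_is_monoid_morphism.

Definition W_scale (c : R[i]) (w : W) : W := W_class c%:MP * w.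

Fact W_scaleA a b w : W_scale a (W_scale b w) = W_scale (a * b) w.
Proof. by rewrite /W_scale mulrA -rmorphM -mpolyCM. Qed.

Fact W_scale1 : left_id 1 W_scale.
Proof. by move=> w; rewrite /W_scale mpolyC1 rmorph1 mul1r. Qed.

Fact W_scaleDr : right_distributive W_scale +%R.
Proof. by move=> a v w; rewrite /W_scale mulrDr. Qed.

Fact W_scaleDl w : {morph W_scale^~ w : a b / a + b}.
Proof. by move=> a b; rewrite /W_scale mpolyCD rmorphD mulrDl. Qed.

HB.instance Definition _ :=
  GRing.Zmodule_isLmodule.Build R[i] W W_scaleA W_scale1 W_scaleDr W_scaleDl.

End W.

(** * The space F *)

(* The variables psi(i), phi(i) are ordered as
   ... psi(0) phi(0) psi(1) phi(1) ... and numbered by int along this order: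
   psi(i) has number 2 i and phi(i) has number 2 i + 1.  A semi-infinite
   monomial, written in this order, is the set of the numbers of its factors.
   These monomials agree up to sign with those in which the finitely many
   trailing psi's are written before the trailing phi's. *)
Definition semi_infinite (S : set int) : Prop :=
  exists M N : int, [set s | s <= M] `<=` S /\ S `<=` [set s | s <= N].

Record monomial := Monomial {
  factors :> set int;
  _ : `[< semi_infinite factors >] }.

HB.instance Definition _ := [isSub for factors].
HB.instance Definition _ := [Choice of monomial by <:].

Lemma semi_infinite_vac (m : int) : semi_infinite [set s | s <= m].
Proof. by exists m, m; split=> s. Qed.

(* v(2N) ends with psi(N), numbered 2N, and v(2N+1) with phi(N), numbered
   2N+1. *)
Definition vac (m : int) : monomial := Monomial (asboolT (semi_infinite_vac m)).

Lemma semi_infinite_add (p : int) (S : monomial) : semi_infinite (p |` S).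
Proof.
case: S => S /= /asboolP[M [N [SM SN]]]; exists M, (Num.max p N); split.
  by move=> s /SM; right.
move=> s [->|/SN /=]; first by rewrite /= le_max lexx.
by rewrite le_max orbC => ->.
Qed.

Definition add_factor (p : int) (S : monomial) : monomial :=
  Monomial (asboolT (semi_infinite_add p S)).

Section Fock.
Variable R : realType.

Definition F := {freeg monomial / R[i]}.

HB.instance Definition _ := GRing.Lmodule.on F.

(* Right multiplication of a monomial by the variable numbered p: the new
   factor is moved to its place past the factors numbered q > p. *)
Definition mul_factor (p : int) (S : monomial) : F :=
  if `[< factors S p >] then 0
  else (-1) ^+ #|` fset_set [set q | factors S q /\ p < q]| *:
       << add_factor p S >>.

Definition psi (i : int) : F -> F := fglift (mul_factor (i *+ 2)).
Definition phi (i : int) : F -> F := fglift (mul_factor (i *+ 2 + 1)).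

(* w |-> \sum_(i + j = m) w psi(i) phi(j); the sum is finitely supported by
   finite_e below. *)
Definition e (m : int) (w : F) : F :=
  \sum_(i \in [set: int]) phi (m - i) (psi i w).

Lemma fglift_add (K : choiceType) (V : lmodType R[i]) (g : K -> V) :
  {morph fglift g : v w / v + w}.
Proof.
move=> v w; have gB := lift_is_additive g.
have g0 : fglift g 0 = 0 by rewrite -[X in fglift g X](subrr 0) gB subrr.
by rewrite -[w in LHS]opprK gB -[- w]add0r gB g0 add0r opprK.
Qed.

Lemma fgliftE (K : choiceType) (V : lmodType R[i]) (g : K -> V) w :
  fglift g w = \sum_(x <- dom w) coeff x w *: g x.
Proof.
have g0 : fglift g 0 = 0.
  by rewrite -[X in fglift g X](subrr 0) lift_is_additive subrr.
rewrite -[w in LHS]freeg_sumE; elim: (dom w) => [|x s IH]; first by rewrite !big_nil.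
by rewrite !big_cons fglift_add IH liftU.
Qed.

Lemma dom_mul_factor (p : int) (w : F) (T : monomial) :
  T \in dom (fglift (mul_factor p) w) ->
  exists2 S, S \in dom w & factors S `<=` factors T.
Proof.
rewrite fgliftE => /dom_sum_subset /flattenP[t /mapP[S]].
rewrite filter_predT => Sw -> /domZ_subset; rewrite /mul_factor.
case: ifP => _; first by rewrite dom0.
move=> /domZ_subset; rewrite domU1 inE => /eqP ->.
by exists S => // s Ss; right.
Qed.

Lemma mul_factor_eq0 (p : int) (w : F) :
  {in dom w, forall S, factors S p} -> fglift (mul_factor p) w = 0.
Proof.
move=> wp; rewrite fgliftE big_seq big1 // => S /wp Sp.
by rewrite /mul_factor asboolT // scaler0.
Qed.

Lemma finite_e (m : int) (w : F) :
  finite_set [set i | phi (m - i) (psi i w) != 0].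
Proof.
have [M wM] : exists M : int,
    {in dom w, forall S s, s <= M -> factors S s}.
  elim: (dom w) => [|S s [M sM]]; first by exists 0.
  have /asboolP[N [P [SN _]]] := valP S.
  exists (Num.min M N) => T; rewrite inE => /orP[/eqP ->|/sM TM] x.
    by rewrite le_min => /andP[_ /SN].
  by rewrite le_min => /andP[/TM].
pose B := (`|m| + `|M|)%N.
apply: (@sub_finite_set _ _ ((fun x : nat => x%:Z - B%:Z - 1) @` `I_(B + B + 2)));
  last exact/finite_image/finite_II.
move=> i /= neq0; exists (absz (i + B%:Z + 1)).
all: have iM : ~~ (i *+ 2 <= M) by
  apply: contra neq0 => iM;
  rewrite [psi i w]mul_factor_eq0 ?/phi ?fgliftE ?dom0 ?big_nil// => S Sw;
  exact: wM iM.
all: have jM : ~~ ((m - i) *+ 2 + 1 <= M) by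
  apply: contra neq0 => jM;
  rewrite [phi _ _]mul_factor_eq0// => T /dom_mul_factor[S Sw ST];
  exact/ST/(wM _ Sw).
all: rewrite /= /B in iM jM *; lia.
Qed.

(** * The tensor powers of F *)

(* F^{(x)k}, with basis the k-tuples of monomials *)
Definition Ften (k : nat) := {freeg {ffun 'I_k -> monomial} / R[i]}.

HB.instance Definition _ k := GRing.Lmodule.on (Ften k).

(* x_1 (x) ... (x) x_k; the sum is finitely supported by finite_tensor
   below. *)
Definition tensor k (x : 'I_k -> F) : Ften k :=
  \sum_(t \in [set: {ffun 'I_k -> monomial}])
    (\prod_j coeff (t j) (x j)) *: << t >>.

Lemma finite_tensor k (x : 'I_k -> F) :
  finite_set [set t : {ffun 'I_k -> monomial} | \prod_j coeff (t j) (x j) != 0].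
Proof.
pose s := flatten [seq dom (x j) | j <- enum 'I_k].
pose h (g : {ffun 'I_k -> seq_sub s}) : {ffun 'I_k -> monomial} :=
  [ffun j => ssval (g j)].
apply: (@sub_finite_set _ _ (h @` setT)); last exact: finite_image.
move=> t /= /prodf_neq0 tx.
have ts j : t j \in s.
  apply/flattenP; exists (dom (x j)); first by apply/mapP; exists j; rewrite ?mem_enum.
  by rewrite mem_dom tx.
by exists [ffun j => SeqSub (ts j)] => //; apply/ffunP => j; rewrite !ffunE.
Qed.

(* T_1 (x) ... (x) T_k, for linear operators T_j *)
Definition tensor_op k (T : 'I_k -> F -> F) : Ften k -> Ften k :=
  fglift (fun t : {ffun 'I_k -> monomial} => tensor (fun j => T j << t j >>)).

Definition e_ten k (m : int) (w : Ften k) : Ften k :=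
  \sum_(r < k) tensor_op (fun j => if j == r then e m else id) w.

(* Action of C[e_0, ..., e_(n-1)]; the e_i commute, so the order of composition
   is irrelevant. *)
Definition act_mnm k n (mu : 'X_{1..n}) (w : Ften k) : Ften k :=
  foldr (fun i : 'I_n => iter (mu i) (e_ten (i : nat)%:Z)) w (enum 'I_n).

Definition act k n (P : {mpoly R[i][n]}) (w : Ften k) : Ften k :=
  \sum_(mu <- msupp P) P@_mu *: act_mnm mu w.

Lemma act_is_linear k n (w : Ften k) :
  linear (fun P : {mpoly R[i][n]} => act P w).
Proof.
have actE N S : (msize S <= N)%N ->
    act S w = \sum_(m : 'X_{1..n < N}) S@_m *: act_mnm m w.
  move=> SN; pose I : subFinType _ := 'X_{1..n < N}.
  rewrite /act (big_mksub I) ?msupp_uniq //=; first last.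
    by move=> x /msize_mdeg_lt /leq_trans; apply.
  by rewrite big_rmcond //= => j /memN_msupp_eq0 ->; rewrite scale0r.
move=> c P Q; pose N := maxn (msize (c *: P + Q)) (maxn (msize P) (msize Q)).
rewrite !(actE N) ?leq_max ?leqnn ?orbT // scaler_sumr -big_split /=.
by apply: eq_bigr => m _; rewrite mcoeffD mcoeffZ scalerDl scalerA.
Qed.

(** * The submodule C[e_s, ..., e_(n-1)] u *)

Lemma shift_ord_subproof s n (i : 'I_(n - s)) : (i + s < n)%N.
Proof. by rewrite addnC -ltn_subRL. Qed.

Definition shift_ord s n (i : 'I_(n - s)) : 'I_n := Ordinal (shift_ord_subproof i).

(* The embedding C[e_0, ..., e_(n-s-1)] -> C[e_0, ..., e_(n-1)],
   e_i |-> e_(i+s).  Its image is C[e_s, ..., e_(n-1)], on which its inverse is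
   the ring isomorphism e_i |-> e_(i-s). *)
Definition shift s n (P : {mpoly R[i][n - s]}) : {mpoly R[i][n]} :=
  P \mPo [tuple 'X_(shift_ord i) | i < n - s].

Section Submodule.
Variables (s n k : nat) (u : Ften k).

Definition in_submod : {pred Ften k} := fun w =>
  `[< exists P : {mpoly R[i][n - s]}, w = act (shift P) u >].

Lemma in_submod_closed : submod_closed in_submod.
Proof.
split.
  by apply/asboolP; exists 0; rewrite /shift comp_mpoly0 /act msupp0 big_nil.
move=> c v w /asboolP[P ->] /asboolP[Q ->]; apply/asboolP.
exists (c *: P + Q).
by rewrite /shift comp_mpolyD comp_mpolyZ act_is_linear.
Qed.

HB.instance Definition _ :=
  GRing.isSubmodClosed.Build R[i] (Ften k) in_submod in_submod_closed.

Record submod := Submod { submod_val :> Ften k; _ : submod_val \in in_submod }.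

HB.instance Definition _ := [isSub for submod_val].
HB.instance Definition _ := [Choice of submod by <:].
HB.instance Definition _ := [SubChoice_isSubZmodule of submod by <:].
HB.instance Definition _ := [SubZmodule_isSubLmodule of submod by <:].

Lemma act_in_submod (P : {mpoly R[i][n - s]}) : act (shift P) u \in in_submod.
Proof. by apply/asboolP; exists P. Qed.

Definition act_submod (P : {mpoly R[i][n - s]}) : submod :=
  Submod (act_in_submod P).

Lemma gen_in_submod : u \in in_submod.
Proof.
apply/asboolP; exists 1; rewrite /shift comp_mpoly1 /act msupp1 big_seq1.
rewrite mcoeff1 eqxx scale1r /act_mnm.
by elim: (enum 'I_n) => //= i r <-; rewrite mnm0E.
Qed.

Definition gen_submod : submod := Submod gen_in_submod.

End Submodule.

(** * The vectors v_A and u *)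

Section Vectors.
Variables (n : nat) (A : n.-tuple nat).

Definition mult (j : nat) : nat := count_mem j A.

Definition partial_mult (j : nat) : nat := (\sum_(1 <= i < j.+1) mult i)%N.

(* The tensor factor with index j : 'I_k is the (j + 1)-st one. *)
Definition v_A (k : nat) : Ften k :=
  tensor (fun j : 'I_k => << vac (-1 + (partial_mult j.+1)%:Z) >>).

Definition u_A (k l : nat) : Ften k :=
  tensor_op
    (fun j : 'I_k => if (j.+1 < l)%N then e (partial_mult j.+1)%:Z else id)
    (v_A k).

End Vectors.

End Fock.

Arguments v_A R {n} A k.
Arguments u_A R {n} A k l.
Arguments W R {n} A.
Arguments W_class R {n} A P.
Arguments submod {R} s n {k} u.
Arguments gen_submod {R} s n {k} u.
Arguments act_submod {R} s n {k} u P.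

(* Main.v *)
Require Import Defs.
From HB Require Import structures.
From mathcomp Require Import all_boot all_order all_algebra.
From mathcomp Require Import finmap ssrcomplements freeg mpoly.
From mathcomp Require Import boolp classical_sets cardinality fsbigop.
From mathcomp Require Import reals complex zify ring.

Set Implicit Arguments.
Unset Strict Implicit.
Unset Printing Implicit Defensive.

Import Order.TTheory GRing.Theory Num.Theory.
Local Open Scope ring_scope.

(** Write v(p) for the vacuum whose last factor has number p.  Since e_p v(p-1)
   is v(p+1) up to sign, the vector u is, up to a nonzero scalar, a tensor
   product of vacuums v(t_j - 1), where all the t_j are at least s (s = 2 in
   part a, s = 1 in part b).  Hence the theorem is a description of the
   annihilator of such a product in a ring C[e_s, ..., e_(s+n-1)], where n now
   is the number of variables: after the renaming of e_(s+i) into e_i it is the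
   ideal I(t) generated by the coefficients of z^b, b < o(i), in e(z)^i, where
   o(i) is the sum over m < n of (i - N_m)_+ and N_m is the number of the j with
   t_j <= s + m.  The numbers N_m + 1 are the entries of A', so that o is the
   order which defines J^A'.

   The ideal I(t) kills the product (order_ideal_kills).  The current of one
   factor has square zero, and on v(t_j - 1) it is divisible by z^(t_j - s); the
   modes e_m with m >= s + n are absorbed in one more summand, divisible by
   z^n.  In the i-th power of the sum of all these only the products of i
   summands survive in which none but the last one is repeated.

   Conversely, an element P which kills the product lies in I(t)
   (emode_act_order_ideal).  This is an induction on n, and for given n on the
   number Z of the factors with t_j = s.

   - If Z > 0, replace one t_j = s by s + 1 and the least t_j >= s + 2 by
     t_j - 1; such a t_j exists after a trivial factor has been added.  An
     intertwiner maps the old product to the new one (emode_act_exchange), so P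
     kills the new one, and by induction P is in the new ideal.  The new ideal
     is contained in I(t) + (e_0^Z) (order_exchange), so P = J + Q e_0^Z with J
     in I(t).
   - The operator e_s^Z maps the product to a nonzero multiple of the product
     where each t_j = s is replaced by s + 2 (iter_emode_ten_vac).  So Q kills
     that product, in which all the t_j exceed s; there e_s acts by zero, and by
     induction on n the part of Q free of e_0 is in the corresponding ideal, for
     n - 1 variables and s + 1.
   - Multiplication by e_0^Z maps this ideal, and e_0, into I(t)
     (order_ideal_tail).

   The last point is the core.  It follows from a statement on an arbitrary
   polynomial E in z and an ideal modulo which each E^i is divisible by z^o(i)
   (pow_coef_mul_in): the product of the coefficients of z^a in E^p and of z^b
   in E^q, p <= q, is in the ideal as soon as a + b < 2p' + o(p') + o(p+q-p')
   for all p' <= p.  Indeed, with D = z d/dz and L = p + q, the polynomial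
   D^r(E^p') E^(L-p') depends polynomially on p', with degree at most r.  Its
   coefficient of z^(a+b) is in the ideal for p' < p, by induction, and for
   p' > L - p, by symmetry.  These are 2p nodes, so it is in the ideal for p' = p
   and all r < 2p.  As at most 2p of the products of coefficients of E^p and
   E^q of total degree a + b are not known to be in the ideal, a Vandermonde
   argument in the degree finishes the proof. *)

(** * Ideals and polynomials with low coefficients in an ideal *)

Section Ideal.
Variable R : comNzRingType.

Definition ideal (K : R -> Prop) : Prop :=
  [/\ K 0, forall x y, K x -> K y -> K (x + y) & forall a x, K x -> K (a * x)].

Variables (K : R -> Prop) (idK : ideal K).

Lemma ideal0 : K 0. Proof. by case: idK. Qed.
Lemma idealD x y : K x -> K y -> K (x + y). Proof. by case: idK => _ h _; apply: h. Qed.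
Lemma idealMl a x : K x -> K (a * x). Proof. by case: idK => _ _; apply. Qed.
Lemma idealMr a x : K x -> K (x * a). Proof. by rewrite mulrC; apply: idealMl. Qed.
Lemma idealN x : K x -> K (- x). Proof. by rewrite -mulN1r; apply: idealMl. Qed.
Lemma idealB x y : K x -> K y -> K (x - y).
Proof. by move=> Kx Ky; apply/idealD/idealN. Qed.
Lemma idealMn x m : K x -> K (x *+ m).
Proof. by move=> Kx; rewrite -mulr_natr; apply: idealMr. Qed.
Lemma ideal_sum I (r : seq I) (P : pred I) (F : I -> R) :
  (forall i, P i -> K (F i)) -> K (\sum_(i <- r | P i) F i).
Proof. by move=> KF; elim/big_rec: _ => [|i x Pi]; [exact: ideal0 | apply/idealD/KF]. Qed.

Definition low_coef_in (m : nat) (P : {poly R}) : Prop :=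
  forall a, (a < m)%N -> K P`_a.

Lemma low_coef_inW m m' P : (m' <= m)%N -> low_coef_in m P -> low_coef_in m' P.
Proof. by move=> le_m lowP a am; apply/lowP/(leq_trans am). Qed.

Lemma low_coef_inD m P Q :
  low_coef_in m P -> low_coef_in m Q -> low_coef_in m (P + Q).
Proof. by move=> lP lQ a am; rewrite coefD; apply: idealD; auto. Qed.

Lemma low_coef_inM m m' P Q :
  low_coef_in m P -> low_coef_in m' Q -> low_coef_in (m + m') (P * Q).
Proof.
move=> lP lQ a am; rewrite coefM; apply: ideal_sum => i _.
have [im|im] := ltnP i m; first by apply/idealMr/lP.
by apply/idealMl/lQ; have := ltn_ord i; lia.
Qed.

Lemma low_coef_inMl m P Q : low_coef_in m P -> low_coef_in m (Q * P).
Proof. by move=> lP; apply: (@low_coef_inM 0). Qed.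

Lemma low_coef_inMn m P k : low_coef_in m P -> low_coef_in m (P *+ k).
Proof. by move=> lP a am; rewrite coefMn; apply/idealMn/lP. Qed.

End Ideal.

(** * Products of coefficients of two powers of a polynomial *)

Section Interpolation.
Variables (R : idomainType) (K : R -> Prop) (idK : ideal K).
Hypothesis divK : forall m x, K (x *+ m.+1) -> K x.

Lemma ideal_nat_sub (a b : nat) x : a != b -> K (x * (a%:R - b%:R)) -> K x.
Proof.
wlog ab : a b / (b < a)%N.
  move=> hw ab; case: (ltnP b a) => [lt_ba|le_ab]; first exact: hw.
  move=> /(idealN idK); rewrite -mulrN opprB; apply: hw; rewrite 1?eq_sym//.
  by rewrite ltn_neqAle ab.
move=> _; rewrite -natrB ?(ltnW ab)// mulr_natr.
by rewrite -[(a - b)%N]prednK ?subn_gt0//; apply: divK.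
Qed.

(** A Vandermonde argument over a quotient which need not be a field: split off
   the linear factor of one node, and divide by the differences of nodes, which
   are nonzero integers. *)
Lemma coef_in_of_nodes (rs : seq nat) (Q : {poly R}) :
    uniq rs -> (size Q <= size rs)%N -> {in rs, forall r, K Q.[r%:R]} ->
  forall i, K Q`_i.
Proof.
elim: rs Q => [|r rs IH] Q /=.
  by rewrite leqn0 size_poly_eq0 => _ /eqP -> _ i; rewrite coef0; apply: ideal0.
case/andP=> r_rs rs_uniq szQ KQ.
have /factor_theorem[Q1 Q1E] : root (Q - Q.[r%:R]%:P) r%:R.
  by rewrite /root !hornerE subrr.
have QE : Q = Q1 * ('X - r%:R%:P) + Q.[r%:R]%:P by rewrite -Q1E subrK.
have KQr : K Q.[r%:R] by apply: KQ; rewrite mem_head.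
have szQ1 : (size Q1 <= size rs)%N.
  have [->|Q10] := eqVneq Q1 0; first by rewrite size_poly0.
  have := size_Mmonic Q10 (monicXsubC r%:R); rewrite -Q1E size_XsubC addn2 /=.
  rewrite -ltnS => <-; rewrite (leq_trans (size_polyD _ _))// geq_max szQ.
  by rewrite size_polyN (leq_trans (size_polyC_leq1 _)).
have KQ1 : {in rs, forall r', K Q1.[r'%:R]}.
  move=> r' r'rs; apply: (@ideal_nat_sub r' r).
    by apply: contraNneq r_rs => <-.
  have -> : Q1.[r'%:R] * (r'%:R - r%:R) = Q.[r'%:R] - Q.[r%:R].
    by rewrite [in Q.[r'%:R]]QE !hornerE addrK.
  by apply: idealB => //; apply: KQ; rewrite inE r'rs orbT.
have KcQ1 := IH _ rs_uniq szQ1 KQ1.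
move=> i; rewrite QE coefD coefC mulrBr coefB coefMX coefMC.
apply: idealD => //; last by case: eqP => // _; apply: ideal0.
by apply: idealB => //; [case: eqP => // _; apply: ideal0 | apply: idealMr].
Qed.

(** The derivation z d/dz; unlike d/dz it preserves the degree, so that its
   iterates multiply a coefficient by a power of its index. *)
Definition theta (P : {poly R}) : {poly R} := 'X * P^`().

Lemma thetaM P Q : theta (P * Q) = theta P * Q + P * theta Q.
Proof. by rewrite /theta derivM; ring. Qed.
Lemma thetaMn P m : theta (P *+ m) = theta P *+ m.
Proof. by rewrite /theta derivMn mulrnAr. Qed.
Lemma theta_sum I (r : seq I) (F : I -> {poly R}) :
  theta (\sum_(i <- r) F i) = \sum_(i <- r) theta (F i).
Proof. by rewrite /theta linear_sum mulr_sumr. Qed.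

Lemma theta_exp E p : E * theta (E ^+ p) = E ^+ p * theta E *+ p.
Proof.
rewrite /theta deriv_exp; case: p => [|p]; first by rewrite !mulr0n !mulr0.
by rewrite /= exprS !mulrnAr; congr (_ *+ _); ring.
Qed.

Lemma coef_iter_theta r P a : (iter r theta P)`_a = P`_a * a%:R ^+ r.
Proof.
elim: r a => [|r IH] a /=; first by rewrite mulr1.
rewrite coefXM; case: a => [|a] /=; first by rewrite exprS mul0r mulr0.
by rewrite coef_deriv IH exprSr mulrA mulr_natr.
Qed.

(** Up to powers of E, the r-th derivative of E^p divided by E^p is a polynomial
   in p of degree at most r, by induction from the Leibniz rule. *)
Lemma theta_pow_polynomial E r :
  exists h : nat -> {poly R}, forall p,
    E ^+ r * iter r theta (E ^+ p) = E ^+ p * \sum_(j < r.+1) h j *+ p ^ j.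
Proof.
elim: r => [|r [h IH]].
  by exists (fun=> 1) => p; rewrite mul1r big_ord1 mulr1.
exists (fun j => (if j is j'.+1 then theta E * h j' else 0) +
  (if (j <= r)%N then E * theta (h j) - theta E * h j *+ r else 0)) => p.
have {IH} := IH p; set S := \sum_(j < r.+1) h j *+ p ^ j => IH.
have -> : \sum_(j < r.+2) ((if j : nat is j'.+1 then theta E * h j' else 0) +
  (if (j <= r)%N then E * theta (h j) - theta E * h j *+ r else 0)) *+ p ^ j =
   theta E * S *+ p + (E * theta S - theta E * S *+ r).
  under eq_bigr do rewrite mulrnDl.
  rewrite big_split /=; congr (_ + _).
    rewrite big_ord_recl mul0rn add0r mulr_sumr -sumrMnl.
    by apply: eq_bigr => j _; rewrite lift0 expnSr mulrnA mulrnAr.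
  rewrite big_ord_recr /= ltnn mul0rn addr0 theta_sum !mulr_sumr -sumrMnl -sumrB.
  apply: eq_bigr => j _; rewrite -ltnS ltn_ord mulrnBl thetaMn !mulrnAr.
  by rewrite -!mulrnA mulnC.
have eqT : E ^+ r * theta (iter r theta (E ^+ p)) =
    theta (E ^+ p) * S + E ^+ p * theta S - theta (E ^+ r) * iter r theta (E ^+ p).
  by rewrite -thetaM -IH thetaM addrAC subrr add0r.
have eqp := theta_exp E p; have eqr := theta_exp E r.
rewrite -mulr_natr in eqp; rewrite -mulr_natr in eqr.
rewrite iterS exprS -mulrA eqT -!(mulr_natr (theta E * S)).
clearbody S; move: eqp eqr IH.
move: (iter r theta (E ^+ p)) (theta (E ^+ p)) (theta (E ^+ r)) => T tEp tEr.
move: (theta E) (theta S) (E ^+ p) (E ^+ r) => tE tS Ep Er eqp eqr IH.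
transitivity (E * tEp * S + E * Ep * tS - E * tEr * T).
  by rewrite /=; ring.
rewrite eqp eqr.
transitivity (Ep * tE * p%:R * S + E * Ep * tS - tE * r%:R * (Er * T)); first by ring.
by rewrite IH; ring.
Qed.

Variables (E : {poly R}) (E_neq0 : E != 0).

(** The sum is the coefficient of z^N in theta^r(E^p) E^(L-p), in which the
   powers of E multiply to E^(L-r) whatever p is; for that one cancels E^r. *)
Lemma weighted_coef_polynomial N L r : (r <= L)%N ->
  exists2 Q : {poly R}, (size Q <= r.+1)%N &
    forall p, (p <= L)%N ->
      \sum_(a < N.+1) (E ^+ p)`_a * (E ^+ (L - p))`_(N - a) * a%:R ^+ r =
      Q.[p%:R].
Proof.
move=> rL; have [h hE] := theta_pow_polynomial E r.
exists (\poly_(j < r.+1) (E ^+ (L - r) * h j)`_N); first exact: size_poly.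
move=> p pL; rewrite horner_poly.
have -> : \sum_(a < N.+1) (E ^+ p)`_a * (E ^+ (L - p))`_(N - a) * a%:R ^+ r =
    (iter r theta (E ^+ p) * E ^+ (L - p))`_N.
  by rewrite coefM; apply: eq_bigr => a _; rewrite coef_iter_theta mulrAC.
have -> : iter r theta (E ^+ p) * E ^+ (L - p) =
    E ^+ (L - r) * \sum_(j < r.+1) h j *+ p ^ j.
  apply: (mulfI (expf_neq0 r E_neq0)).
  rewrite mulrA hE [RHS]mulrA -exprD subnKC// mulrAC -exprD subnKC//.
rewrite mulr_sumr coef_sum; apply: eq_bigr => j _.
by rewrite mulrnAr coefMn -natrX mulr_natr.
Qed.

(** Let L = p + q.  The induction on p' <= p is over all products of
   coefficients of E^p' and E^(L-p') of total degree a + b at once: those with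
   exponents p' < s give, together with their mirror images p' > L - s, the 2s
   nodes of the interpolation at s. *)
Theorem pow_coef_mul_in (o : nat -> nat) (p q a b : nat) :
    (forall i, low_coef_in K (o i) (E ^+ i)) -> (p <= q)%N ->
    (forall p', (p' <= p)%N -> (a + b < p' + p' + (o p' + o (p + q - p')))%N) ->
  K ((E ^+ p)`_a * (E ^+ q)`_b).
Proof.
move=> lowE pq abN.
pose L := (p + q)%N; pose N := (a + b)%N.
pose X p' c := (E ^+ p')`_c * (E ^+ (L - p'))`_(N - c).
suff main p' : (p' <= p)%N -> forall c, (c <= N)%N -> K (X p' c).
  have := main p (leqnn p) a; rewrite /X /L /N !addKn; apply; lia.
elim/ltn_ind: p' => s IH sp.
(* The exponents below s and, by symmetry, above L - s. *)
pose nodes := iota 0 s ++ iota (L - s).+1 s.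
have nodes_uniq : uniq nodes.
  rewrite cat_uniq !iota_uniq andbT /=; apply/hasPn => r.
  by rewrite !mem_iota /L; lia.
have Knode r t : t \in nodes -> (r < s + s)%N ->
    K (\sum_(c < N.+1) X t c * c%:R ^+ r).
  rewrite mem_cat !mem_iota => /orP[t_s|t_s] _; apply: ideal_sum => // c _;
    apply: idealMr => //.
    by apply: IH; [lia|lia| have := ltn_ord c; lia].
  rewrite /X mulrC.
  have /= := IH (L - t)%N _ _ (N - c)%N _; rewrite /X !subKn.
    apply; first by rewrite /L in t_s *; lia.
      by rewrite /L in t_s *; lia.
    by have := ltn_ord c; lia.
    by have := ltn_ord c; lia.
  by rewrite /L in t_s *; lia.
(* Interpolation in the exponent. *)
have Kmoment r : (r < s + s)%N -> K (\sum_(c < N.+1) X s c * c%:R ^+ r).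
  move=> rs; have rL : (r <= L)%N by rewrite /L; lia.
  have [Q szQ QE] := weighted_coef_polynomial N rL.
  rewrite QE; last by rewrite /L; lia.
  have KQ : forall i, K Q`_i.
    apply: (@coef_in_of_nodes nodes) => //.
      by rewrite size_cat !size_iota (leq_trans szQ).
    move=> t t_nodes; rewrite -QE; first exact: Knode.
    by move: t_nodes; rewrite mem_cat !mem_iota /L; lia.
  by rewrite horner_coef; apply: ideal_sum => // i _; apply: idealMr.
move=> c0 c0N.
pose al := o s; pose be := o (L - s)%N.
have out c : (c <= N)%N -> ~~ ((al <= c) && (be <= N - c))%N -> K (X s c).
  move=> cN; rewrite negb_and -!ltnNge => /orP[cal|cbe].
    by apply: idealMr => //; apply: lowE.
  by apply: idealMl => //; apply: lowE.
have [win0|/(out _ c0N)//] := boolP ((al <= c0) && (be <= N - c0))%N.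
(* Apart from the indices from al to N - be, one of the two factors is in the
   ideal.  A polynomial weight, of degree below 2s, which vanishes at all these
   indices but c0 isolates the product of index c0. *)
pose others := [seq c <- iota al (N.+1 - be - al) | c != c0].
pose w : {poly R} := \prod_(x <- [seq c%:R | c <- others]) ('X - x%:P).
have szw : (size w <= s + s)%N.
  rewrite size_prod_XsubC size_map size_filter.
  have := count_predC (pred1 c0) (iota al (N.+1 - be - al)).
  rewrite size_iota count_uniq_mem ?iota_uniq// mem_iota.
  have := abN s sp; rewrite -/al -/L -/be => lt1 cnt.
  have -> : count (fun c => c != c0) (iota al (N.+1 - be - al)) =
    count (predC (pred1 c0)) (iota al (N.+1 - be - al)) by [].
  by rewrite /N in cnt win0 *; lia.
have Kw : K (\sum_(c < N.+1) X s c * w.[c%:R]).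
  under eq_bigr do rewrite horner_coef mulr_sumr.
  rewrite exchange_big /=; apply: ideal_sum => // r _.
  have -> : \sum_(c < N.+1) X s c * (w`_r * c%:R ^+ r) =
      w`_r * \sum_(c < N.+1) X s c * c%:R ^+ r.
    by rewrite mulr_sumr; apply: eq_bigr => c _; rewrite mulrCA.
  by apply: idealMl => //; apply/Kmoment/(leq_trans (ltn_ord r)).
have c0N' : (c0 < N.+1)%N by [].
have Kc0 : K (X s c0 * w.[c0%:R]).
  rewrite (bigD1 (Ordinal c0N')) //= in Kw.
  rewrite -[X in K X](addrK (\sum_(i < N.+1 | i != Ordinal c0N') X s i * w.[i%:R])).
  apply: idealB => //; apply: ideal_sum => // c cc0.
  have [winc|/out h] := boolP ((al <= c) && (be <= N - c))%N; last first.
    by apply: idealMr => //; apply: h; rewrite -ltnS.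
  suff -> : w.[c%:R] = 0 by rewrite mulr0; apply: ideal0.
  apply/rootP; rewrite /w root_prod_XsubC.
  apply/mapP; exists (c : nat) => //.
  rewrite mem_filter mem_iota; apply/andP; split; last by have := ltn_ord c; lia.
  by apply: contra cc0 => /eqP cc0; apply/eqP/val_inj.
move: Kc0; rewrite /w big_map horner_prod; have : all (fun c => c != c0) others.
  exact: filter_all.
elim: (others) => [|c cs IHc] /=; first by rewrite big_nil mulr1.
case/andP=> cc0 cs0; rewrite big_cons hornerXsubC mulrCA mulrC => /ideal_nat_sub Kc.
by apply: IHc => //; apply: Kc; rewrite eq_sym.
Qed.

End Interpolation.

(** * Polynomials in commuting operators *)

Section Action.
Variable C : comNzRingType.

Section Def.
Variables (M : lmodType C) (n : nat) (T : 'I_n -> M -> M).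

Definition mnm_act (mu : 'X_{1..n}) (w : M) : M :=
  foldr (fun i => iter (mu i) (T i)) w (enum 'I_n).

Definition poly_act (P : {mpoly C[n]}) (w : M) : M :=
  \sum_(mu <- msupp P) P@_mu *: mnm_act mu w.

Lemma poly_actwE N P w : (msize P <= N)%N ->
  poly_act P w = \sum_(m : 'X_{1..n < N}) P@_m *: mnm_act m w.
Proof.
move=> PN; pose I : subFinType _ := 'X_{1..n < N}.
rewrite /poly_act (big_mksub I) ?msupp_uniq //=; last first.
  by move=> x /msize_mdeg_lt /leq_trans; apply.
by rewrite big_rmcond //= => j /memN_msupp_eq0 ->; rewrite scale0r.
Qed.

Lemma poly_act_is_linear w : linear (poly_act^~ w).
Proof.
move=> c P Q; pose N := maxn (msize (c *: P + Q)) (maxn (msize P) (msize Q)).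
rewrite !(@poly_actwE N) ?leq_max ?leqnn ?orbT // scaler_sumr -big_split /=.
by apply: eq_bigr => m _; rewrite mcoeffD mcoeffZ scalerDl scalerA.
Qed.

Lemma poly_actD P Q w : poly_act (P + Q) w = poly_act P w + poly_act Q w.
Proof. by have := poly_act_is_linear w 1 P Q; rewrite !scale1r. Qed.

Lemma poly_act0 w : poly_act 0 w = 0.
Proof. by rewrite /poly_act msupp0 big_nil. Qed.

Lemma poly_actZ c P w : poly_act (c *: P) w = c *: poly_act P w.
Proof. by have := poly_act_is_linear w c P 0; rewrite !addr0 poly_act0 addr0. Qed.

Lemma poly_act_sum I (r : seq I) (Q : pred I) (F : I -> {mpoly C[n]}) w :
  poly_act (\sum_(i <- r | Q i) F i) w = \sum_(i <- r | Q i) poly_act (F i) w.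
Proof.
by elim/big_rec2: _ => [|i v P _ <-]; rewrite ?poly_act0 ?poly_actD.
Qed.

Lemma poly_actXm mu w : poly_act 'X_[mu] w = mnm_act mu w.
Proof. by rewrite /poly_act msuppX big_seq1 mcoeffX eqxx scale1r. Qed.

Lemma poly_act1 w : poly_act 1 w = w.
Proof.
rewrite -mpolyX0 poly_actXm /mnm_act.
by elim: (enum 'I_n) => //= i r ->; rewrite mnm0E.
Qed.

Lemma poly_actX i w : poly_act 'X_i w = T i w.
Proof.
rewrite poly_actXm /mnm_act.
have : i \in enum 'I_n by rewrite mem_enum.
have : uniq (enum 'I_n) by exact: enum_uniq.
have F0 s : i \notin s -> foldr (fun j => iter (U_( i)%MM j) (T j)) w s = w.
  elim: s => //= j s IH; rewrite inE negb_or => /andP[ij /IH ->].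
  by rewrite mnm1E (negbTE ij).
elim: (enum 'I_n) => //= j r IH; case/andP=> jr r_uniq; rewrite inE mnm1E.
have [eij|ij] := eqVneq i j; first by move=> _ /=; rewrite F0 eij.
by move=> /= ir; rewrite IH.
Qed.

End Def.

Lemma mnm_act_morph (M M' : lmodType C) n (T : 'I_n -> M -> M)
    (T' : 'I_n -> M' -> M') (g : M -> M') mu w :
    (forall i v, g (T i v) = T' i (g v)) ->
  g (mnm_act T mu w) = mnm_act T' mu (g w).
Proof.
move=> gT; rewrite /mnm_act; elim: (enum 'I_n) => //= i r <-.
by elim: (mu i) => //= m <-.
Qed.

Lemma poly_act_morph (M M' : lmodType C) n (T : 'I_n -> M -> M)
    (T' : 'I_n -> M' -> M') (g : {linear M -> M'}) P w :
    (forall i v, g (T i v) = T' i (g v)) ->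
  g (poly_act T P w) = poly_act T' P (g w).
Proof.
move=> gT; rewrite /poly_act linear_sum /=; apply: eq_bigr => mu _.
by rewrite linearZ /= (mnm_act_morph _ _ gT).
Qed.

(** The modes of F^(x)k are given by nicer formulas on the span of the vectors
   which contain all the negative factors; this lemma replaces the operators on
   such an invariant set. *)
Lemma eq_poly_act_in (M : lmodType C) n (T T' : 'I_n -> M -> M) (S : M -> Prop) P w :
    (forall i v, S v -> T i v = T' i v /\ S (T' i v)) -> S w ->
  poly_act T P w = poly_act T' P w.
Proof.
move=> TT' Sw; apply: eq_bigr => mu _; congr (_ *: _); rewrite /mnm_act.
suff [] : foldr (fun i => iter (mu i) (T i)) w (enum 'I_n) =
    foldr (fun i => iter (mu i) (T' i)) w (enum 'I_n) /\
  S (foldr (fun i => iter (mu i) (T' i)) w (enum 'I_n)) by [].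
elim: (enum 'I_n) => //= i r [-> Sr].
by elim: (mu i) => //= m [-> Sm]; apply: TT'.
Qed.

Section Commuting.
Variables (M : lmodType C) (n : nat) (T : 'I_n -> {linear M -> M}).
Hypothesis commT : forall i j w, T i (T j w) = T j (T i w).

Lemma mnm_actM mu nu w : mnm_act T (mu + nu)%MM w = mnm_act T mu (mnm_act T nu w).
Proof.
have iter_comm (g : M -> M) i m v : (forall j u, g (T j u) = T j (g u)) ->
  g (iter m (T i) v) = iter m (T i) (g v) by move=> h; elim: m => //= m <-.
rewrite /mnm_act; elim: (enum 'I_n) => //= i r IH.
rewrite mnmDE iterD IH; congr (iter _ _ _).
set v := foldr _ w r; clearbody v; elim: r {IH} v => //= j r IHr v.
rewrite -IHr iter_comm//= => j' u.
by elim: (nu i) => //= m ->; apply: commT.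
Qed.

Lemma mnm_act_linear mu : linear (mnm_act T mu).
Proof.
move=> c v w; rewrite /mnm_act; elim: (enum 'I_n) => //= i r ->.
by elim: (mu i) => //= m ->; rewrite linearP.
Qed.

Lemma poly_act_linear P : linear (poly_act T P).
Proof.
move=> c v w; rewrite /poly_act scaler_sumr -big_split /=.
by apply: eq_bigr => mu _; rewrite mnm_act_linear scalerDr !scalerA mulrC.
Qed.

Lemma poly_act0r P : poly_act T P 0 = 0.
Proof.
have := poly_act_linear P 1 0 0; rewrite !scale1r !addr0 => /esym/eqP.
by rewrite -subr_eq0 addrK => /eqP.
Qed.

Lemma poly_actZr P c w : poly_act T P (c *: w) = c *: poly_act T P w.
Proof. by have := poly_act_linear P c w 0; rewrite !addr0 poly_act0r addr0. Qed.

Lemma poly_act_sumr P I (r : seq I) (G : I -> M) :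
  poly_act T P (\sum_(i <- r) G i) = \sum_(i <- r) poly_act T P (G i).
Proof.
elim: r => [|i r IH]; first by rewrite !big_nil poly_act0r.
by rewrite !big_cons -IH -[G i in LHS]scale1r poly_act_linear scale1r.
Qed.

Lemma poly_actM P Q w : poly_act T (P * Q) w = poly_act T P (poly_act T Q w).
Proof.
rewrite [in LHS](mpolyE P) mulr_suml poly_act_sum; apply: eq_bigr => mu _.
rewrite -scalerAl poly_actZ; congr (_ *: _).
rewrite [in LHS](mpolyE Q) mulr_sumr poly_act_sum.
rewrite -poly_actXm [poly_act T Q w]/poly_act poly_act_sumr.
apply: eq_bigr => nu _.
by rewrite -scalerAr poly_actZ poly_actZr -mpolyXD !poly_actXm mnm_actM.
Qed.

Lemma annihilator_ideal w : ideal (fun P => poly_act T P w = 0).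
Proof.
split=> [|P Q Pw Qw|P Q Qw]; first exact: poly_act0.
  by rewrite poly_actD Pw Qw addr0.
by rewrite poly_actM Qw poly_act0r.
Qed.

Lemma poly_act_exp P m w : poly_act T (P ^+ m) w = iter m (poly_act T P) w.
Proof. by elim: m => [|m IH]; rewrite ?poly_act1// exprS poly_actM IH. Qed.

(** Both the renaming of variables and the splitting of a mode into its
   components on the tensor factors are substitutions. *)
Lemma poly_act_comp n' (lq : n'.-tuple {mpoly C[n]}) (T' : 'I_n' -> M -> M) P w :
    (forall i v, T' i v = poly_act T (tnth lq i) v) ->
  poly_act T (P \mPo lq) w = poly_act T' P w.
Proof.
move=> T'E; rewrite comp_mpolyE poly_act_sum; apply: eq_bigr => mu _.
rewrite poly_actZ; congr (_ *: _); rewrite /mnm_act -big_enum.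
elim: (enum 'I_n') => [|i r IH]; first by rewrite big_nil poly_act1.
rewrite big_cons poly_actM IH poly_act_exp /=.
by apply: eq_iter => v; rewrite T'E.
Qed.

End Commuting.
End Action.

(** * Linear maps on free modules *)

Section Freeg.
Variable (R : comNzRingType) (K : choiceType).

Lemma fglift_is_linear (V : lmodType R) (g : K -> V) : linear (fglift g).
Proof.
have gB := lift_is_additive g.
have g0 : fglift g 0 = 0 by rewrite -[X in fglift g X](subrr 0) gB subrr.
have gD v w : fglift g (v + w) = fglift g v + fglift g w.
  by rewrite -[w in LHS]opprK gB -[- w]add0r gB g0 sub0r opprK.
have gE w : fglift g w = \sum_(x <- dom w) coeff x w *: g x.
  rewrite -[w in LHS]freeg_sumE.
  elim: (dom w) => [|x s IH]; first by rewrite !big_nil.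
  by rewrite !big_cons gD IH liftU.
have gZ c w : fglift g (c *: w) = c *: fglift g w.
  rewrite [in RHS]gE -[in LHS](freeg_sumE w).
  elim: (dom w) => [|x s IH]; first by rewrite !big_nil !scaler0 g0.
  rewrite !big_cons !scalerDr gD IH scalerA; congr (_ + _).
  rewrite -(liftU g); congr (fglift _ _).
  by apply/eqP/freeg_eqP => y; rewrite coeffZ !coeffU mulrA.
by move=> c v w; rewrite gD gZ.
Qed.

HB.instance Definition _ (V : lmodType R) (g : K -> V) :=
  GRing.isLinear.Build R {freeg K / R} V _ (fglift g) (fglift_is_linear g).

Lemma fgliftU (V : lmodType R) (g : K -> V) x : fglift g << x >> = g x.
Proof. by rewrite liftU scale1r. Qed.

Lemma freeg_linear_ext (V : lmodType R) (f g : {linear {freeg K / R} -> V}) :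
  (forall x, f << x >> = g << x >>) -> f =1 g.
Proof.
move=> fg w; rewrite -[w]freeg_sumE !linear_sum; apply: eq_bigr => x _.
have -> : << coeff x w *g x >> = coeff x w *: << x >> :> {freeg K / R}.
  by apply/eqP/freeg_eqP => y; rewrite coeffZ !coeffU mul1r.
by rewrite !linearZ /= fg.
Qed.

End Freeg.

(** * Creation and annihilation operators on F *)

Section Signs.
Local Open Scope classical_set_scope.

(** The factors past which the variable numbered c has to be moved. *)
Definition above (c : int) (S : set int) : set int := [set q | S q /\ c < q].

Lemma finite_above c (S : monomial) : finite_set (above c S).
Proof.
have /asboolP[_ [N [_ SN]]] := valP S.
apply: (@sub_finite_set _ _ ((fun x : nat => x%:Z + c) @` `I_(`|N - c|.+1)));
  last exact/finite_image/finite_II.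
move=> q [/SN /= qN cq]; exists `|q - c|%N => /=; lia.
Qed.

Definition n_above c (S : monomial) : nat := #|` fset_set (above c S)|.

Lemma n_above_add c p (S : monomial) : ~ factors S p ->
  n_above c (add_factor p S) = (n_above c S + (c < p)%R)%N.
Proof.
move=> Sp; rewrite /n_above.
have [cp|pc] := boolP (c < p).
  have -> : above c (add_factor p S) = p |` above c S.
    apply/seteqP; split=> q /=.
      by case=> -[->|Sq] cq; [left | right].
    by case=> [->|[Sq cq]]; split=> //; [left | right].
  rewrite fset_setU1; last exact: finite_above.
  rewrite cardfsU1 addnC; congr (_ + _)%N; congr nat_of_bool.
  rewrite in_fset_set; last exact: finite_above.
  by apply/negP; rewrite inE => -[].
rewrite addn0; congr (#|` fset_set _|).
apply/seteqP; split=> q /=; last by case=> Sq cq; split=> //; right.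
by case=> -[->|Sq] cq; [rewrite cq in pc | split].
Qed.

Lemma semi_infinite_del (p : int) (S : monomial) : semi_infinite (factors S `\ p).
Proof.
have /asboolP[M [N [SM SN]]] := valP S; exists (Num.min M (p - 1)), N; split.
  move=> s /=; rewrite le_min => /andP[/SM Ss sp]; split=> // sp'; lia.
by move=> s [/SN].
Qed.

Definition del_factor (p : int) (S : monomial) : monomial :=
  Monomial (asboolT (semi_infinite_del p S)).

Lemma monomial_eq (S T : monomial) : factors S `<=>` factors T -> S = T.
Proof. by move=> /seteqP ST; apply: val_inj. Qed.

Lemma add_factorC p q S : add_factor p (add_factor q S) = add_factor q (add_factor p S).
Proof. by apply: monomial_eq; split=> s /=; intuition. Qed.

Lemma del_factorK p (S : monomial) : factors S p -> add_factor p (del_factor p S) = S.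
Proof.
move=> Sp; apply: monomial_eq; split=> s /=; first by case=> [->|[]].
by move=> Ss; have [->|/eqP sp] := eqVneq s p; [left | right].
Qed.

Lemma add_factorK p (S : monomial) : ~ factors S p -> del_factor p (add_factor p S) = S.
Proof.
move=> Sp; apply: monomial_eq; split=> s /=; first by case=> -[].
by move=> Ss; split; [right | move=> sp; apply: Sp; rewrite -sp].
Qed.

Lemma del_add_factor p q S : p != q ->
  del_factor p (add_factor q S) = add_factor q (del_factor p S).
Proof.
move=> /eqP pq; apply: monomial_eq; split=> s /=; intuition.
Qed.

Lemma n_above_del c p (S : monomial) : factors S p ->
  n_above c S = (n_above c (del_factor p S) + (c < p)%R)%N.
Proof. by move=> Sp; rewrite -n_above_add ?del_factorK// => -[_ /=]; apply. Qed.

End Signs.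

Section FockOperators.
Variable R : realType.
Local Notation F := (F R).

Definition create (c : int) : F -> F := fglift (mul_factor R c).

(** The adjoint of the multiplication by a variable. *)
Definition mul_del (p : int) (S : monomial) : F :=
  if `[< factors S p >] then (-1) ^+ n_above p S *: << del_factor p S >> else 0.

Definition annihilate (c : int) : F -> F := fglift (mul_del c).

HB.instance Definition _ c := GRing.Linear.on (create c).
HB.instance Definition _ c := GRing.Linear.on (annihilate c).

Lemma createE c (S : monomial) : create c << S >> =
  if `[< factors S c >] then 0 else (-1) ^+ n_above c S *: << add_factor c S >>.
Proof. exact: fgliftU. Qed.

Lemma annihilateE c (S : monomial) : annihilate c << S >> =
  if `[< factors S c >] then (-1) ^+ n_above c S *: << del_factor c S >> else 0.
Proof. exact: fgliftU. Qed.

End FockOperators.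

Section FockRelations.
Variable R : realType.
Local Notation F := (F R).
Local Notation create := (@create R).
Local Notation annihilate := (@annihilate R).

Lemma create_in c (S : monomial) : factors S c -> create c << S >> = 0.
Proof. by move=> Sc; rewrite createE asboolT. Qed.

Lemma create_notin c (S : monomial) : ~ factors S c ->
  create c << S >> = (-1) ^+ n_above c S *: << add_factor c S >>.
Proof. by move=> Sc; rewrite createE asboolF. Qed.

Lemma annihilate_notin c (S : monomial) : ~ factors S c -> annihilate c << S >> = 0.
Proof. by move=> Sc; rewrite annihilateE asboolF. Qed.

Lemma annihilate_in c (S : monomial) : factors S c ->
  annihilate c << S >> = (-1) ^+ n_above c S *: << del_factor c S >>.
Proof. by move=> Sc; rewrite annihilateE asboolT. Qed.

Lemma eq_signr m n : odd m = odd n -> (-1) ^+ m = (-1) ^+ n :> R[i].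
Proof. by move=> mn; rewrite -[LHS]signr_odd mn signr_odd. Qed.

Lemma createZ c (a : R[i]) w : create c (a *: w) = a *: create c w.
Proof. exact: linearZ. Qed.

Lemma annihilateZ c (a : R[i]) w : annihilate c (a *: w) = a *: annihilate c w.
Proof. exact: linearZ. Qed.

Lemma lt_addn_parity (a b : int) : a != b -> ((a < b)%R + (b < a)%R = 1)%N.
Proof. by lia. Qed.

Lemma create_anticomm a b w : create a (create b w) = - create b (create a w).
Proof.
suff: [the {linear F -> F} of create a \o create b] w =
      [the {linear F -> F} of \- (create b \o create a)] w by [].
apply: freeg_linear_ext => S /=.
have [<-|ab] := eqVneq a b.
  have -> : create a (create a << S >>) = 0; last by rewrite oppr0.
  have [Sa|Sa] := pselect (factors S a); first by rewrite create_in// linear0.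
  by rewrite create_notin// createZ create_in ?scaler0//; left.
have [Sa|Sa] := pselect (factors S a).
  rewrite [create a << S >>]create_in// linear0 oppr0.
  have [Sb|Sb] := pselect (factors S b); first by rewrite create_in// linear0.
  by rewrite create_notin// createZ create_in ?scaler0//; right.
have [Sb|Sb] := pselect (factors S b).
  rewrite create_in// linear0 create_notin// createZ create_in; last by right.
  by rewrite scaler0 oppr0.
rewrite create_notin// createZ create_notin; last by case=> // /eqP; apply/negP.
rewrite create_notin// createZ create_notin; last first.
  by case=> // /eqP; rewrite eq_sym; apply/negP.
rewrite !n_above_add// add_factorC !scalerA -!exprD -[in RHS]scaleN1r scalerA -exprS.
congr (_ *: _); apply: eq_signr; have := lt_addn_parity ab; lia.
Qed.

(** The canonical anticommutation relation.  For a and b distinct, exactly one of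
   the two variables has to be moved past the other. *)
Lemma annihilate_create a b w :
  annihilate a (create b w) = (a == b)%:R *: w - create b (annihilate a w).
Proof.
suff: [the {linear F -> F} of annihilate a \o create b] w =
   [the {linear F -> F} of ((a == b)%:R \*: idfun \- (create b \o annihilate a))%R] w
  by [].
apply: freeg_linear_ext => S /=.
have [<-|ab] := eqVneq a b.
  rewrite scale1r; have [Sa|Sa] := pselect (factors S a).
    rewrite create_in// linear0 annihilate_in// createZ create_notin; last first.
      by case=> _ /=; apply.
    rewrite scalerA -exprD del_factorK// (n_above_del a Sa) ltxx addn0.
    by rewrite -signr_odd oddD addbb scale1r subrr.
  rewrite annihilate_notin// linear0 subr0 create_notin// annihilateZ.
  rewrite annihilate_in; last by left.
  by rewrite n_above_add// ltxx addn0 add_factorK// scalerA -expr2 sqrr_sign scale1r.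
rewrite scale0r sub0r; have [Sb|Sb] := pselect (factors S b).
  rewrite create_in// linear0; have [Sa|Sa] := pselect (factors S a); last first.
    by rewrite annihilate_notin// linear0 oppr0.
  rewrite annihilate_in// createZ create_in ?scaler0 ?oppr0//.
  by split=> // /eqP; rewrite eq_sym; apply/negP.
have [Sa|Sa] := pselect (factors S a); last first.
  rewrite create_notin// annihilateZ annihilate_notin.
    by rewrite annihilate_notin// linear0 !linear0.
  by case=> // /eqP; apply/negP.
rewrite create_notin// annihilateZ annihilate_in; last by right.
rewrite annihilate_in// createZ create_notin; last by case.
rewrite del_add_factor// n_above_add// (n_above_del b Sa).
rewrite !scalerA -!exprD -[in RHS]scaleN1r scalerA -exprS.
congr (_ *: _); apply: eq_signr; have := lt_addn_parity ab; lia.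
Qed.

(** The vacuum v(t-1) of the space F; the shift by one makes t the least mode
   that does not kill it. *)
Definition vac_below (t : nat) : monomial := vac (-1 + t%:Z).

Lemma create_vac0 c t : c < t%:Z -> create c << vac_below t >> = 0.
Proof. by move=> ct; rewrite create_in//=; lia. Qed.

Lemma n_above_vac t : n_above t%:Z (vac_below t) = 0%N.
Proof.
rewrite /n_above (_ : above _ _ = set0) ?fset_set0 ?cardfs0//.
by apply/seteqP; split=> // q [/= ? ?]; lia.
Qed.

Lemma add_factor_vac t : add_factor t%:Z (vac_below t) = vac_below t.+1.
Proof. by apply: monomial_eq; split=> s /=; [case=> [->|] | ]; lia. Qed.

Lemma create_vac t : create t%:Z << vac_below t >> = << vac_below t.+1 >>.
Proof.
rewrite create_notin; last by rewrite /=; lia.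
by rewrite n_above_vac scale1r add_factor_vac.
Qed.

Lemma annihilate_vac0 c t : t%:Z <= c -> annihilate c << vac_below t >> = 0.
Proof. by move=> ct; rewrite annihilate_notin//=; lia. Qed.

Lemma annihilate_vac t : annihilate t%:Z << vac_below t.+1 >> = << vac_below t >>.
Proof.
rewrite -create_vac annihilate_create eqxx scale1r annihilate_vac0//.
by rewrite linear0 subr0.
Qed.

(** The truncation of e_m to nonnegative indices of psi and phi.  It is a finite
   sum of products of variables on the whole space, and it agrees with e_m on
   the vectors which contain all the factors with negative number. *)
Definition emode (m : nat) (w : F) : F :=
  \sum_(i < m.+1) create ((m - i)%N%:Z *+ 2 + 1) (create (i%:Z *+ 2) w).

Lemma emode_is_linear m : linear (emode m).
Proof.
move=> c v w; rewrite /emode scaler_sumr -big_split /=.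
by apply: eq_bigr => i _; rewrite !linearP.
Qed.

HB.instance Definition _ m := GRing.isLinear.Build R[i] F F _ (emode m) (emode_is_linear m).

Definition filled (w : F) : Prop := {in dom w, forall S s, s < 0 -> factors S s}.

Lemma e_emode m w : filled w -> e m%:Z w = emode m w.
Proof.
move=> fw; pose r := [seq i%:Z | i <- iota 0 m.+1].
have r_uniq : uniq r by rewrite map_inj_uniq ?iota_uniq// => ? ? [].
have F0 i : setT i -> i \notin r -> phi (m%:Z - i) (psi i w) = 0.
  move=> _ im; have [i0|i0] := ltP i 0.
    have -> : psi i w = 0; last by rewrite /phi linear0.
    by apply: mul_factor_eq0 => S Sw; apply: (fw S Sw); lia.
  apply: mul_factor_eq0 => T /dom_mul_factor[S Sw]; apply.
  apply: (fw S Sw).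
  suff : m%:Z < i by lia.
  rewrite ltNge; apply: contra im => im.
  by apply/mapP; exists `|i|%N; rewrite ?mem_iota; lia.
rewrite /e (fsbigE r _ r_uniq _ F0) // big_map -[iota 0 m.+1]/(index_iota 0 m.+1) big_mkord.
apply: eq_big => i; first by rewrite in_setT.
by move=> _; rewrite /phi /psi subzn// -ltnS.
Qed.

End FockRelations.

(** * The modes on one factor *)

Section EModes.
Variable R : realType.
Local Notation F := (F R).
Local Notation create := (@create R).
Local Notation annihilate := (@annihilate R).
Local Notation emode := (@emode R).

Lemma create_emode c m w : create c (emode m w) = emode m (create c w).
Proof.
rewrite /emode linear_sum; apply: eq_bigr => i _ /=.
by rewrite create_anticomm [create c (create _ w)]create_anticomm linearN opprK.
Qed.

Lemma emode_comm a b w : emode a (emode b w) = emode b (emode a w).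
Proof.
rewrite {1 4}/emode linear_sum; apply: eq_bigr => i _.
by rewrite /= -2!create_emode.
Qed.

(** Annihilating the variable c leaves its partner in the sum e_m: the variables
   which multiply in e_m have numbers of sum 2m + 1.  The sign tells whether c is
   the psi or the phi of the pair. *)
Lemma annihilate_emode (c m : nat) w :
  annihilate c%:Z (emode m w) = emode m (annihilate c%:Z w) -
  (if (c <= m.*2.+1)%N then (-1) ^+ c *: create (m.*2.+1 - c)%N%:Z w else 0).
Proof.
pose r (i : nat) := (c%:Z == (m - i)%N%:Z *+ 2 + 1)%:R *: create (i%:Z *+ 2) w -
   (c%:Z == i%:Z *+ 2)%:R *: create ((m - i)%N%:Z *+ 2 + 1) w.
transitivity (emode m (annihilate c%:Z w) + \sum_(i < m.+1) r i).
  rewrite /emode linear_sum -big_split; apply: eq_bigr => i _.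
  rewrite /= annihilate_create annihilate_create linearB/= createZ /r.
  by rewrite opprB addrCA.
congr (_ + _); have [cm|mc] := leqP c m.*2.+1; last first.
  rewrite oppr0 big1 // => i _; rewrite /r.
  have -> : (c%:Z == (m - i)%N%:Z *+ 2 + 1) = false by apply/eqP; lia.
  have -> : (c%:Z == i%:Z *+ 2) = false by apply/eqP; have := ltn_ord i; lia.
  by rewrite !scale0r subr0.
have im : ((if odd c then m - c./2 else c./2) < m.+1)%N.
  by have := odd_double_half c; case: odd => /=; lia.
rewrite (bigD1 (Ordinal im)) //= big1 => [|i i0]; last first.
  have {}i0 : (i : nat) != (if odd c then m - c./2 else c./2)%N.
    by apply: contra i0 => /eqP i0; apply/eqP/val_inj.
  rewrite /r.
  have -> : (c%:Z == (m - i)%N%:Z *+ 2 + 1) = false.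
    by apply/eqP; have := odd_double_half c; have := ltn_ord i; case: odd i0 => /=; lia.
  have -> : (c%:Z == i%:Z *+ 2) = false.
    by apply/eqP; have := odd_double_half c; have := ltn_ord i; case: odd i0 => /=; lia.
  by rewrite !scale0r subr0.
rewrite addr0 /r -signr_odd; have := odd_double_half c; case: odd im => /= im cE.
  have -> : (c%:Z == (m - (m - c./2))%N%:Z *+ 2 + 1) by apply/eqP; lia.
  have -> : (c%:Z == (m - c./2)%N%:Z *+ 2) = false by apply/eqP; lia.
  rewrite scale0r subr0 scale1r expr1 scaleN1r opprK; congr (create _ w); lia.
have -> : (c%:Z == (m - c./2)%N%:Z *+ 2 + 1) = false by apply/eqP; lia.
have -> : (c%:Z == (c./2)%:Z *+ 2) by apply/eqP; lia.
rewrite scale0r sub0r !scale1r; congr (- create _ w); lia.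
Qed.

Lemma emode_vac0 m t : (m < t)%N -> emode m << vac_below t >> = 0.
Proof.
move=> mt; rewrite /emode big1// => i _.
have [it|ti] := ltP (i%:Z *+ 2) t%:Z; first by rewrite create_vac0// linear0.
by rewrite create_anticomm create_vac0 ?linear0 ?oppr0//; have := ltn_ord i; lia.
Qed.

Lemma emode_vac t : emode t << vac_below t >> = (-1) ^+ t *: << vac_below t.+2 >>.
Proof.
have it : (uphalf t < t.+1)%N by rewrite uphalf_half; have := odd_double_half t; lia.
rewrite /emode (bigD1 (Ordinal it)) //= big1 => [|i i0]; last first.
  have {}i0 : (i : nat) != uphalf t.
    by apply: contra i0 => /eqP i0; apply/eqP/val_inj.
  have [i_t|ti] := ltP (i%:Z *+ 2) t%:Z; first by rewrite create_vac0// linear0.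
  rewrite create_anticomm create_vac0 ?linear0 ?oppr0//; have := ltn_ord i.
  by move: i0; rewrite uphalf_half; have := odd_double_half t; case: odd => /=; lia.
rewrite addr0 -signr_odd; have := odd_double_half t.
move: it; rewrite uphalf_half; case: odd => /= it tE.
  have -> : ((1 + t./2)%N%:Z *+ 2) = t.+1%:Z by lia.
  have -> : (t - (1 + t./2))%N%:Z *+ 2 + 1 = t%:Z by lia.
  by rewrite create_anticomm !create_vac expr1 scaleN1r.
have -> : ((0 + t./2)%N%:Z *+ 2) = t%:Z by lia.
have -> : (t - (0 + t./2))%N%:Z *+ 2 + 1 = t.+1%:Z by lia.
by rewrite !create_vac scale1r.
Qed.

Lemma emode_sumE M m w : (m < M)%N -> emode m w = \sum_(a < M) \sum_(p < M)
  create (p%:Z *+ 2 + 1) (create (a%:Z *+ 2) w) *+ (p + a == m)%N.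
Proof.
move=> mM; rewrite /emode (big_ord_widen_cond M xpredT
  (fun i => create ((m - i)%N%:Z *+ 2 + 1) (create (i%:Z *+ 2) w))) //=.
rewrite big_mkcond /=; apply: eq_bigr => a _; have [am|ma] := leqP a m.
  have pM : (m - a < M)%N by lia.
  rewrite ltnS am (bigD1 (Ordinal pM)) //= subnK// eqxx mulr1n big1 ?addr0// => p.
  move/eqP => pma; have -> : (p + a == m)%N = false.
    by apply/eqP => pam; apply/pma/val_inj => /=; lia.
  by [].
by rewrite ltnS leqNgt ma /= big1// => p _; have -> : (p + a == m)%N = false by lia.
Qed.

(** The square of the current e(z) = psi(z) phi(z) vanishes: exchanging the two
   psi's in the coefficient of z^m changes its sign. *)
Lemma emode_sq m w : \sum_(i < m.+1) emode i (emode (m - i) w) = 0.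
Proof.
pose G (a p b q : 'I_m.+1) := create (p%:Z *+ 2 + 1) (create (a%:Z *+ 2)
  (create (q%:Z *+ 2 + 1) (create (b%:Z *+ 2) w))) *+ (a + b + (p + q) == m)%N.
set S := (X in X = 0).
have SE : S = \sum_a \sum_b \sum_p \sum_q G a p b q.
  rewrite /S; transitivity (\sum_(i < m.+1) \sum_(a < m.+1) \sum_(p < m.+1)
      \sum_(b < m.+1) \sum_(q < m.+1)
      create (p%:Z *+ 2 + 1) (create (a%:Z *+ 2)
      (create (q%:Z *+ 2 + 1) (create (b%:Z *+ 2) w))) *+
        ((q + b == m - i) * (p + a == i))%N).
    apply: eq_bigr => i _; rewrite (emode_sumE _ (ltn_ord i)).
    apply: eq_bigr => a _; apply: eq_bigr => p _.
    rewrite (@emode_sumE m.+1 (m - i) w) ?ltnS ?leq_subr//.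
    rewrite !linear_sum -sumrMnl; apply: eq_bigr => b _.
    rewrite !linear_sum -sumrMnl; apply: eq_bigr => q _.
    by rewrite !linearMn /= mulrnA.
  rewrite exchange_big; apply: eq_bigr => a _.
  rewrite exchange_big /=; under eq_bigr do rewrite exchange_big /=.
  rewrite exchange_big; apply: eq_bigr => b _; apply: eq_bigr => p _.
  rewrite exchange_big; apply: eq_bigr => q _; rewrite /G sumrMnr.
  congr (_ *+ _); have [abpq|abpq] := eqVneq (a + b + (p + q))%N m; last first.
    by rewrite big1// => i _; have := ltn_ord i; lia.
  have ipa : (p + a < m.+1)%N by lia.
  rewrite (bigD1 (Ordinal ipa)) //= big1 ?addn0 => [|i]; first by lia.
  by rewrite -val_eqE /=; lia.
have SN : S = - S.
  rewrite {1}SE exchange_big SE -sumrN; apply: eq_bigr => a _.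
  rewrite -sumrN; apply: eq_bigr => b _.
  rewrite -sumrN; apply: eq_bigr => p _.
  rewrite -sumrN; apply: eq_bigr => q _.
  rewrite /G -mulNrn [(a + b)%N]addnC; congr (_ *+ _).
  rewrite -linearN /=; congr (create _ _).
  rewrite [LHS]create_anticomm [X in - create _ X]create_anticomm linearN opprK /=.
  by rewrite [in RHS]create_anticomm opprK.
move/eqP: SN; rewrite -subr_eq0 opprK -mulr2n -scaler_nat.
by rewrite scaler_eq0 pnatr_eq0 /= => /eqP.
Qed.

Lemma filled_vac t : filled (<< vac_below t >> : F).
Proof. by move=> S; rewrite domU1 inE => /eqP -> s /=; lia. Qed.

Lemma filled_create c w : filled w -> filled (create c w).
Proof. by move=> fw T /dom_mul_factor[S Sw ST] s /(fw S Sw); apply: ST. Qed.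

Lemma filledD v w : filled v -> filled w -> filled (v + w : F).
Proof. by move=> fv fw S /domD_subset; rewrite mem_cat => /orP[/fv|/fw]. Qed.

Lemma filled0 : filled (0 : F). Proof. by move=> S; rewrite dom0. Qed.

Lemma filled_emode m w : filled w -> filled (emode m w).
Proof.
move=> fw; rewrite /emode; elim/big_ind: _ => [||i _]; first exact: filled0.
  by move=> *; apply: filledD.
exact/filled_create/filled_create.
Qed.

End EModes.

(** * Operators on the tensor powers *)

Section Tensor.
Variables (R : realType) (k : nat).
Local Notation F := (F R).
Local Notation Ften := (Ften R k).
Local Notation emode := (@emode R).
Implicit Types (t : {ffun 'I_k -> monomial}) (r : 'I_k).

Definition set_factor t r (S : monomial) : {ffun 'I_k -> monomial} :=
  [ffun j => if j == r then S else t j].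

Lemma set_factor_id t r S S' : set_factor (set_factor t r S) r S' = set_factor t r S'.
Proof. by apply/ffunP => j; rewrite !ffunE; case: eqP. Qed.

Lemma set_factorC t r r' S S' : r != r' ->
  set_factor (set_factor t r S) r' S' = set_factor (set_factor t r' S') r S.
Proof.
move=> rr'; apply/ffunP => j; rewrite !ffunE; case: (eqVneq j r') => // ->.
by rewrite eq_sym (negbTE rr').
Qed.

Lemma set_factorE t r S : set_factor t r S r = S.
Proof. by rewrite ffunE eqxx. Qed.

Lemma set_factor_neq t r r' S : r != r' -> set_factor t r S r' = t r'.
Proof. by move=> rr'; rewrite ffunE eq_sym (negbTE rr'). Qed.

(** The tensor product of w, at place r, with the factors of t at the other
   places. *)
Definition insert_at t r : F -> Ften := fglift (fun S => << set_factor t r S >>).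

HB.instance Definition _ t r := GRing.Linear.on (insert_at t r).

Lemma insert_atU t r S : insert_at t r << S >> = << set_factor t r S >>.
Proof. exact: fgliftU. Qed.

Lemma insert_at_id t r S w : insert_at (set_factor t r S) r w = insert_at t r w.
Proof.
by apply: freeg_linear_ext w => S'; rewrite /= !insert_atU set_factor_id.
Qed.

Definition at_factor r (T : F -> F) : Ften -> Ften :=
  fglift (fun t => insert_at t r (T << t r >>)).

HB.instance Definition _ r T := GRing.Linear.on (at_factor r T).

Lemma at_factorU r T t : at_factor r T << t >> = insert_at t r (T << t r >>).
Proof. exact: fgliftU. Qed.

Lemma at_factor_insert r (T : {linear F -> F}) t w :
  at_factor r T (insert_at t r w) = insert_at t r (T w).
Proof.
suff : [the {linear F -> Ften} of at_factor r T \o insert_at t r] w =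
   [the {linear F -> Ften} of insert_at t r \o T] w by [].
apply: freeg_linear_ext => S /=.
by rewrite insert_atU at_factorU insert_at_id set_factorE.
Qed.

Lemma at_factor_comp r (T : {linear F -> F}) (T' : F -> F) w :
  at_factor r T (at_factor r T' w) = at_factor r (T \o T') w.
Proof.
suff : [the {linear Ften -> Ften} of at_factor r T \o at_factor r T'] w =
   at_factor r (T \o T') w by [].
by apply: freeg_linear_ext => t /=; rewrite !at_factorU at_factor_insert.
Qed.

Lemma insert_atE t r w :
  insert_at t r w = \sum_(S <- dom w) coeff S w *: << set_factor t r S >>.
Proof. exact: fgliftE. Qed.

Lemma at_factorC r r' (T T' : F -> F) w : r != r' ->
  at_factor r T (at_factor r' T' w) = at_factor r' T' (at_factor r T w).
Proof.
move=> rr'.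
suff : [the {linear Ften -> Ften} of at_factor r T \o at_factor r' T'] w =
   [the {linear Ften -> Ften} of at_factor r' T' \o at_factor r T] w by [].
apply: freeg_linear_ext => t /=; rewrite !at_factorU !insert_atE !linear_sum /=.
under eq_bigr do rewrite linearZ /= at_factorU insert_atE scaler_sumr.
under [RHS]eq_bigr do rewrite linearZ /= at_factorU insert_atE scaler_sumr.
under eq_bigr do rewrite set_factor_neq 1?eq_sym//.
under [RHS]eq_bigr do rewrite set_factor_neq//.
rewrite exchange_big; apply: eq_bigr => S _; apply: eq_bigr => S' _.
by rewrite !scalerA mulrC set_factorC // eq_sym.
Qed.

Lemma eq_at_factor r (T T' : F -> F) : T =1 T' -> at_factor r T =1 at_factor r T'.
Proof.
move=> TT' w; apply: freeg_linear_ext w => t.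
by rewrite /= !at_factorU TT'.
Qed.

(** The sum defining the tensor product is over an infinite type, but only
   finitely many of its terms are nonzero. *)
Lemma coeff_tensor (x : 'I_k -> F) t : coeff t (tensor x) = \prod_j coeff (t j) (x j).
Proof.
pose r := fset_set [set t : {ffun 'I_k -> monomial} | \prod_j coeff (t j) (x j) != 0]%classic.
have rP s : (s \in r) = (\prod_j coeff (s j) (x j) != 0).
  by rewrite in_fset_set; [apply/idP/idP; rewrite inE | exact: finite_tensor].
rewrite /tensor (fsbigE r _ (fset_uniq r)) // => [|s _]; last first.
  by rewrite rP negbK => /eqP ->; rewrite scale0r.
rewrite raddf_sum /= big_mkcond /=.
under eq_bigr do rewrite in_setT coeffZ coeffU mul1r.
have [tr|] := boolP (t \in r); last first.
  rewrite rP negbK => tr0; rewrite (eqP tr0) big_seq big1 // => s sr.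
  have [st|st] := eqVneq s t; last by rewrite mulr0.
  by move: sr; rewrite st rP tr0.
rewrite (bigD1_seq t) ?fset_uniq//= eqxx mulr1 [X in _ + X]big1 ?addr0// => s /negbTE ->.
by rewrite mulr0.
Qed.

Lemma freeg_eq (v w : Ften) : (forall t, coeff t v = coeff t w) -> v = w.
Proof. by move=> vw; apply/eqP/freeg_eqP. Qed.

Lemma coeff_insert_at t r w s :
  coeff s (insert_at t r w) = coeff (s r) w *+ [forall j, (j != r) ==> (t j == s j)].
Proof.
have -> : coeff s (insert_at t r w) =
    \sum_(S <- dom w) coeff S w * (set_factor t r S == s)%:R.
  rewrite insert_atE raddf_sum; apply: eq_bigr => S _.
  by rewrite /= coeffZ coeffU mul1r.
have E S : (set_factor t r S == s) = (S == s r) && [forall j, (j != r) ==> (t j == s j)].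
  apply/eqP/andP => [<-|[/eqP Ss /forallP ts]].
    rewrite set_factorE eqxx; split=> //; apply/forallP => j; apply/implyP => jr.
    by rewrite set_factor_neq// eq_sym.
  apply/ffunP => j; rewrite ffunE; case: (eqVneq j r) => [->//|jr].
  by have := ts j; rewrite jr => /eqP.
under eq_bigr do rewrite E.
case: forallP => _; last first.
  by rewrite big1// => S _; rewrite andbF mulr0.
under eq_bigr do rewrite andbT.
have [sw|sw] := boolP (s r \in dom w).
  rewrite (bigD1_seq (s r)) ?uniq_dom//= eqxx mulr1 big1 ?addr0// => S /negbTE ->.
  by rewrite mulr0.
rewrite coeff_outdom// big_seq big1// => S Sw.
have [Ss|] := eqVneq S (s r); last by rewrite mulr0.
by rewrite Ss (negbTE sw) in Sw.
Qed.

Lemma tensor_insert r (T : F -> F) t :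
  tensor (fun j => (if j == r then T else id) << t j >>) = insert_at t r (T << t r >>).
Proof.
apply: freeg_eq => s; rewrite coeff_tensor coeff_insert_at (bigD1 r) //= eqxx.
case: forallP => [ts|nts].
  rewrite big1 ?mulr1// => j jr; rewrite (negbTE jr) coeffU mul1r.
  by have := ts j; rewrite jr => /= ->.
have [j]: exists j, ~~ ((j != r) ==> (t j == s j)).
  by apply/existsP; rewrite -negb_forall; apply/negP => /forallP.
rewrite negb_imply => /andP[jr tsj].
by rewrite (bigD1 j) //= (negbTE jr) coeffU mul1r (negbTE tsj) mul0r mulr0.
Qed.

Lemma tensor_scale (c : 'I_k -> R[i]) t :
  tensor (fun j => c j *: << t j >>) = (\prod_j c j) *: << t >>.
Proof.
apply: freeg_eq => s; rewrite coeff_tensor coeffZ coeffU mul1r.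
under eq_bigr do rewrite coeffZ coeffU mul1r.
rewrite big_split /=; congr (_ * _).
have [->|ts] := eqVneq t s; first by rewrite big1// => j _; rewrite eqxx.
have [j] : exists j, t j != s j.
  apply/existsP; rewrite -negb_forall; apply: contra ts => /forallP ts.
  by apply/eqP/ffunP => j; apply/eqP.
by move=> tsj; rewrite (bigD1 j)//= (negbTE tsj) mul0r.
Qed.

Lemma tensor_opU (T : 'I_k -> F -> F) t :
  tensor_op T << t >> = tensor (fun j => T j << t j >>).
Proof. exact: fgliftU. Qed.

Definition emode_ten (m : nat) (w : Ften) : Ften :=
  \sum_(r < k) at_factor r (emode m) w.

Lemma emode_ten_is_linear m : linear (emode_ten m).
Proof.
move=> c v w; rewrite /emode_ten scaler_sumr -big_split /=.
by apply: eq_bigr => i _; rewrite !linearP.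
Qed.

HB.instance Definition _ m :=
  GRing.isLinear.Build R[i] Ften Ften _ (emode_ten m) (emode_ten_is_linear m).

Lemma at_emode_comm r r' a b w :
  at_factor r (emode a) (at_factor r' (emode b) w) =
  at_factor r' (emode b) (at_factor r (emode a) w).
Proof.
have [<-|rr'] := eqVneq r r'; last exact: at_factorC.
by rewrite !at_factor_comp; apply: eq_at_factor => v /=; apply: emode_comm.
Qed.

Lemma emode_ten_comm a b w :
  emode_ten a (emode_ten b w) = emode_ten b (emode_ten a w).
Proof.
rewrite /emode_ten; under eq_bigr do rewrite linear_sum; rewrite exchange_big /=.
under [RHS]eq_bigr do rewrite linear_sum /=.
by apply: eq_bigr => r _; apply: eq_bigr => r' _; apply: at_emode_comm.
Qed.

Definition filled_ten (w : Ften) : Prop := {in dom w, forall t j, filled (<< t j >> : F)}.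

Lemma filled_tenD v w : filled_ten v -> filled_ten w -> filled_ten (v + w).
Proof. by move=> fv fw t /domD_subset; rewrite mem_cat => /orP[/fv|/fw]. Qed.

Lemma filled_tenZ a w : filled_ten w -> filled_ten (a *: w).
Proof. by move=> fw t /domZ_subset /fw. Qed.

Lemma filled_ten0 : filled_ten 0. Proof. by move=> t; rewrite dom0. Qed.

Lemma filled_ten_sum I (s : seq I) (G : I -> Ften) :
  (forall i, filled_ten (G i)) -> filled_ten (\sum_(i <- s) G i).
Proof.
move=> fG; elim/big_ind: _ => [||i _]; [exact: filled_ten0 | | exact: fG].
by move=> *; apply: filled_tenD.
Qed.

Lemma filled_insert t r (w : F) : (forall j, filled (<< t j >> : F)) -> filled w ->
  filled_ten (insert_at t r w).
Proof.
move=> ft fw; rewrite insert_atE => s /dom_sum_subset /flattenP[u /mapP[S]].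
rewrite filter_predT => Sw -> /domZ_subset; rewrite domU1 inE => /eqP -> j S'.
rewrite domU1 inE => /eqP ->; rewrite ffunE; case: eqP => _; first exact: fw.
by apply: (ft j); rewrite domU1 mem_head.
Qed.

Lemma filled_emode_ten m w : filled_ten w -> filled_ten (emode_ten m w).
Proof.
move=> fw; apply: filled_ten_sum => r; rewrite /at_factor fgliftE big_seq.
elim/big_ind: _ => [||t tw]; [exact: filled_ten0 | exact: filled_tenD |].
by apply/filled_tenZ/filled_insert; [exact: fw | apply/filled_emode/fw].
Qed.

Lemma e_ten_emode m w : filled_ten w -> e_ten m%:Z w = emode_ten m w.
Proof.
move=> fw; apply: eq_bigr => r _; rewrite /tensor_op /at_factor !fgliftE.
apply: eq_big_seq => t tw; congr (_ *: _).
rewrite -tensor_insert; congr tensor; apply: functional_extensionality_dep => j.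
by case: eqP => // _; apply/e_emode/fw.
Qed.

(** The tensor product of the vacuums v(t_j - 1). *)
Definition vac_ten (t : 'I_k -> nat) : Ften := << [ffun j => vac_below (t j)] >>.

Definition set_at (t : 'I_k -> nat) r (m : nat) : 'I_k -> nat :=
  fun j => if j == r then m else t j.

Lemma eq_vac_ten (t t' : 'I_k -> nat) : t =1 t' -> vac_ten t = vac_ten t'.
Proof. by move=> tt'; congr (<< _ >>); apply/ffunP => j; rewrite !ffunE tt'. Qed.

Lemma at_factor_vac (T : F -> F) r (t : 'I_k -> nat) c m :
  T << vac_below (t r) >> = c *: << vac_below m >> ->
  at_factor r T (vac_ten t) = c *: vac_ten (set_at t r m).
Proof.
move=> Tt; rewrite at_factorU ffunE Tt linearZ /= insert_atU; congr (_ *: << _ >>).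
by apply/ffunP => j; rewrite !ffunE /set_at; case: eqP.
Qed.

Lemma at_factor_vac0 (T : F -> F) r (t : 'I_k -> nat) :
  T << vac_below (t r) >> = 0 -> at_factor r T (vac_ten t) = 0.
Proof. by move=> Tt; rewrite at_factorU ffunE Tt linear0. Qed.

Lemma filled_vac_ten (t : 'I_k -> nat) : filled_ten (vac_ten t).
Proof.
move=> s; rewrite domU1 inE => /eqP -> j; rewrite ffunE; exact: filled_vac.
Qed.

Lemma vac_ten_neq0 (t : 'I_k -> nat) : vac_ten t != 0.
Proof. by rewrite freegU_eq0 oner_eq0. Qed.

End Tensor.

(** * Comparison of the annihilators of vacuum vectors *)

Section Intertwiners.
Variable R : realType.
Local Notation C := R[i].
Local Notation F := (F R).
Local Notation create := (@create R).
Local Notation annihilate := (@annihilate R).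
Local Notation emode := (@emode R).

(** The operators e_s, ..., e_(s+n-1), as values of the variables e_0, ...,
   e_(n-1). *)
Definition emode_family k s n (i : 'I_n) : {linear Ften R k -> Ften R k} := emode_ten (s + i)%N.

Definition emode_act k s n : {mpoly C[n]} -> Ften R k -> Ften R k :=
  poly_act (fun i => emode_family k s i).

Lemma emode_family_comm k s n (i j : 'I_n) w :
  emode_family k s i (emode_family k s j w) = emode_family k s j (emode_family k s i w).
Proof. exact: emode_ten_comm. Qed.

Section Exchange.
Variables (k : nat) (r1 r2 : 'I_k) (r12 : r1 != r2) (d B : nat).

(** The sum over c of x(c) (x) x*(c+d) +- x*(c+d) (x) x(c), where x and x* are
   the creation and annihilation operators and the other factors are left
   alone.  In the commutator with e_m only the c below 2m + 2 - d contribute,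
   and the contributions of the two terms are opposite under
   c -> 2m + 1 - d - c; so the sum up to a large bound B commutes with e_m. *)
Definition exchange (w : Ften R k) : Ften R k := \sum_(c < B)
  (at_factor r1 (create c%:Z) (at_factor r2 (annihilate (c + d)%N%:Z) w) +
   (-1) ^+ d *: at_factor r1 (annihilate (c + d)%N%:Z) (at_factor r2 (create c%:Z) w)).

Lemma exchange_is_linear : linear exchange.
Proof.
move=> a v w; rewrite /exchange scaler_sumr -big_split /=.
apply: eq_bigr => c _; rewrite !linearP /= !scalerDr !scalerA mulrC.
by rewrite addrACA.
Qed.

HB.instance Definition _ :=
  GRing.isLinear.Build C (Ften R k) (Ften R k) _ exchange exchange_is_linear.

Lemma at_create_emode_ten r c m (w : Ften R k) :
  at_factor r (create c) (emode_ten m w) = emode_ten m (at_factor r (create c) w).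
Proof.
rewrite linear_sum; apply: eq_bigr => r' _ /=; have [->|rr'] := eqVneq r r'.
  by rewrite !at_factor_comp; apply: eq_at_factor => v /=; rewrite create_emode.
exact: at_factorC.
Qed.

Lemma at_annihilate_emode_ten r (c m : nat) (w : Ften R k) :
  at_factor r (annihilate c%:Z) (emode_ten m w) =
  emode_ten m (at_factor r (annihilate c%:Z) w) -
  (if (c <= m.*2.+1)%N then
     (-1) ^+ c *: at_factor r (create (m.*2.+1 - c)%N%:Z) w else 0).
Proof.
rewrite /emode_ten linear_sum (bigD1 r)//= [in RHS](bigD1 r)//= addrAC.
congr (_ + _); last by apply: eq_bigr => r' rr'; rewrite at_factorC// eq_sym.
rewrite !at_factor_comp.
suff : at_factor r (annihilate c%:Z \o emode m) w =
   [the {linear Ften R k -> Ften R k} of at_factor r (emode m \o annihilate c%:Z) \-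
     (if (c <= m.*2.+1)%N then (-1) ^+ c else 0) \*: at_factor r (create (m.*2.+1 - c)%N%:Z)] w.
  by move=> -> /=; case: ifP; rewrite ?scale0r.
apply: freeg_linear_ext w => t /=; rewrite !at_factorU /= annihilate_emode.
by rewrite linearB /=; case: ifP => _; [rewrite linearZ | rewrite linear0 scale0r].
Qed.

Lemma exchange_emode_ten m w : (m.*2.+1 < B)%N ->
  exchange (emode_ten m w) = emode_ten m (exchange w).
Proof.
move=> mB; pose Z a b := at_factor r1 (create a%:Z) (at_factor r2 (create b%:Z) w).
rewrite /exchange linear_sum /=; apply/eqP; rewrite -subr_eq0 -sumrB; apply/eqP.
transitivity (\sum_(c < B | (c < m.*2.+2 - d)%N)
   - ((-1) ^+ (c + d) *: Z c (m.*2.+1 - (c + d))%N + (-1) ^+ c *: Z (m.*2.+1 - (c + d))%N c)).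
  rewrite [RHS]big_mkcond; apply: eq_bigr => c _.
  rewrite at_create_emode_ten !at_annihilate_emode_ten linearB /= at_create_emode_ten.
  rewrite scalerBr linearD /= [emode_ten m (_ *: _)]linearZ /=.
  rewrite addrACA [LHS]addrAC subrr add0r -opprD.
  have -> : (c < m.*2.+2 - d)%N = (c + d <= m.*2.+1)%N by lia.
  case: ifP => _; last by rewrite linear0 scaler0 addr0 oppr0.
  rewrite linearZ /= scalerA -exprD; congr (- (_ + _ *: _)); apply: eq_signr; lia.
rewrite -(big_ord_widen B (fun c : nat => - ((-1) ^+ (c + d) *: Z c (m.*2.+1 - (c + d))%N +
   (-1) ^+ c *: Z (m.*2.+1 - (c + d))%N c))); last by lia.
rewrite sumrN big_split /= [X in _ + X](reindex_inj rev_ord_inj) /= -big_split /=.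
rewrite big1 ?oppr0// => c _; have cd := ltn_ord c.
have -> : (m.*2.+1 - (m.*2.+2 - d - c.+1 + d))%N = c by lia.
have -> : (m.*2.+2 - d - c.+1 = m.*2.+1 - (c + d))%N by lia.
rewrite -scalerDl (_ : _ + _ = 0) ?scale0r//.
have -> : (-1) ^+ (m.*2.+1 - (c + d)) = (-1) ^+ (c + d).+1 :> C.
  by apply: eq_signr; lia.
by rewrite exprS mulN1r subrr.
Qed.

(** Only the term which moves the last variable of the factor r2 to the first
   free place of the factor r1 survives. *)
Lemma exchange_vac (t : 'I_k -> nat) : (t r1 < B)%N -> (t r1 + d).+1 = t r2 -> (0 < d)%N ->
  exchange (vac_ten R t) = vac_ten R (set_at (set_at t r1 (t r1).+1) r2 (t r2).-1).
Proof.
move=> tB td d0; rewrite /exchange (bigD1 (Ordinal tB)) //= big1 => [|c].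
  rewrite (@at_factor_vac _ _ _ _ _ 1 (t r2).-1); last first.
    by rewrite -td annihilate_vac scale1r.
  rewrite scale1r (@at_factor_vac _ _ _ _ _ 1 (t r1).+1); last first.
    by rewrite scale1r /set_at (negbTE r12) create_vac.
  rewrite (@at_factor_vac0 _ _ (create _)) ?linear0 ?scaler0 ?addr0 ?scale1r.
    apply: eq_vac_ten => j; rewrite /set_at; case: (eqVneq j r1) => // ->.
    by rewrite (negbTE r12).
  by rewrite create_vac0// -td; lia.
rewrite -val_eqE /= => cp; have [pc|cp'] := ltnP (t r1) c.
  rewrite (@at_factor_vac0 _ _ (annihilate _)); last first.
    by rewrite annihilate_vac0// -td; lia.
  rewrite linear0 add0r -[at_factor r1 _ _]at_factorC 1?eq_sym//.
  rewrite (@at_factor_vac0 _ _ (annihilate _)) ?linear0 ?scaler0//.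
  by rewrite annihilate_vac0//; lia.
rewrite at_factorC// (@at_factor_vac0 _ _ (create _)); last first.
  by rewrite create_vac0//; lia.
rewrite linear0 add0r (@at_factor_vac0 _ _ (create _)) ?linear0 ?scaler0//.
by rewrite create_vac0// -td; lia.
Qed.

End Exchange.

Lemma emode_act_exchange k s n (t : 'I_k -> nat) r1 r2 (P : {mpoly C[n]}) :
    r1 != r2 -> (t r1 + 2 <= t r2)%N ->
    emode_act s P (vac_ten R t) = 0 ->
  emode_act s P (vac_ten R (set_at (set_at t r1 (t r1).+1) r2 (t r2).-1)) = 0.
Proof.
move=> r12 t12 Pt; pose B := ((s + n).*2.+1 + t r1).+1.
rewrite -(@exchange_vac _ _ _ r12 (t r2 - (t r1).+1) B); try lia.
have PB := @poly_act_morph _ _ _ _ (fun i => emode_family k s i)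
  (fun i => emode_family k s i) (exchange r1 r2 (t r2 - (t r1).+1) B) P (vac_ten R t).
rewrite /emode_act -PB; first by rewrite -/(emode_act s P _) Pt linear0.
by move=> i v; apply: exchange_emode_ten => //; have := ltn_ord i; rewrite /B; lia.
Qed.

Definition raise (s : nat) k (t : 'I_k -> nat) : 'I_k -> nat :=
  fun j => if t j == s then s.+2 else t j.

Lemma emode_ten_vac k (t : 'I_k -> nat) m : (forall j, (m <= t j)%N) ->
  emode_ten m (vac_ten R t) = \sum_(r < k | t r == m) (-1) ^+ m *: vac_ten R (set_at t r m.+2).
Proof.
move=> mt; rewrite [RHS]big_mkcond; apply: eq_bigr => r _.
case: eqVneq => [tr|trm].
  by apply: at_factor_vac; rewrite tr emode_vac.
by apply/at_factor_vac0/emode_vac0; rewrite ltn_neqAle eq_sym trm mt.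
Qed.

(** Each application of e_s raises one more factor v(s-1) to v(s+1), on which
   e_s acts by zero; the factorial counts the orders in which this is done. *)
Lemma iter_emode_ten_vac k (t : 'I_k -> nat) s : (forall j, (s <= t j)%N) ->
  iter #|[pred j | t j == s]| (emode_ten s) (vac_ten R t) =
  ((-1) ^+ (s * #|[pred j | t j == s]|) *+ (#|[pred j | t j == s]|)`!) *:
    vac_ten R (raise s t).
Proof.
have [Z] := ubnP #|[pred j | t j == s]|.
elim: Z t => // Z IH t; rewrite ltnS => tZ st.
case: (posnP #|[pred j | t j == s]|) => [t0|tpos].
  rewrite t0 /= muln0 expr0 mulr1n scale1r; apply: eq_vac_ten => j; rewrite /raise.
  by have /eqP/pred0P/(_ j)/= -> := t0.
pose Z' := #|[pred j | t j == s]|.-1.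
have tZ' : #|[pred j | t j == s]| = Z'.+1 by rewrite prednK.
have card_set r : t r == s -> #|[pred j | set_at t r s.+2 j == s]| = Z'.
  move=> tr; apply/eqP; rewrite -eqSS -tZ' (cardD1 r [pred j | t j == s]) inE tr add1n eqSS.
  apply/eqP/eq_card => j; rewrite !inE /set_at; case: (eqVneq j r) => //= _; lia.
have iterZ m a v : iter m (@emode_ten R k s) (a *: v) = a *: iter m (@emode_ten R k s) v.
  by elim: m => // m; rewrite !iterS => ->; rewrite linearZ.
have iter_sum m (Q : pred 'I_k) G : iter m (@emode_ten R k s) (\sum_(r | Q r) G r) =
    \sum_(r | Q r) iter m (@emode_ten R k s) (G r).
  by elim: m => // m IHm; rewrite iterS IHm linear_sum.
rewrite tZ' iterSr emode_ten_vac// iter_sum.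
rewrite (eq_bigr (fun=> ((-1) ^+ (s * Z'.+1) *+ Z'`!) *: vac_ten R (raise s t))).
  by rewrite sumr_const tZ' scalerMnl -mulrnA factS [(Z'`! * _)%N]mulnC.
move=> r tr; rewrite iterZ -{1}(card_set r tr) IH ?card_set//; last 2 first.
- by rewrite -ltnS -tZ'.
- by move=> j; rewrite /set_at; case: eqP => // _; lia.
- rewrite scalerA mulrnAr -exprD -mulnS; congr (_ *: _).
  apply: eq_vac_ten => j; rewrite /raise /set_at; have [->|//] := eqVneq j r.
  by rewrite tr; case: eqP => //; lia.
Qed.

Definition add_charge k m (t : 'I_k -> nat) : 'I_k.+1 -> nat :=
  fun j => oapp t m (unlift ord0 j).

Section AddFactor.
Variables (k m : nat).

(** The map w |-> v(m-1) (x) w commutes with the modes below m, which kill the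
   vacuum v(m-1). *)
Definition add_monomial (t : {ffun 'I_k -> monomial}) : {ffun 'I_k.+1 -> monomial} :=
  [ffun j => oapp t (vac_below m) (unlift ord0 j)].

Definition add_vac : Ften R k -> Ften R k.+1 := fglift (fun t => << add_monomial t >>).

HB.instance Definition _ := GRing.Linear.on add_vac.

Lemma add_vac_emode_ten i w : (i < m)%N ->
  add_vac (emode_ten i w) = emode_ten i (add_vac w).
Proof.
move=> im.
suff : [the {linear Ften R k -> Ften R k.+1} of add_vac \o emode_ten i] w =
  [the {linear Ften R k -> Ften R k.+1} of emode_ten i \o add_vac] w by [].
apply: freeg_linear_ext => t /=.
have add_U s : add_vac << s >> = << add_monomial s >> by exact: fgliftU.
rewrite add_U linear_sum /emode_ten big_ord_recl /= at_factorU ffunE unlift_none /=.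
rewrite emode_vac0// linear0 add0r; apply: eq_bigr => r _.
rewrite !at_factorU ffunE liftK /=; move: (emode i _) => v.
suff : [the {linear F -> Ften R k.+1} of add_vac \o insert_at t r] v =
  insert_at (add_monomial t) (fintype.lift ord0 r) v by [].
apply: freeg_linear_ext v => S /=; rewrite !insert_atU add_U; congr (<< _ >>).
apply/ffunP => j; rewrite !ffunE.
case: unliftP => [j'|] -> /=; last by [].
by rewrite ffunE (inj_eq lift_inj).
Qed.

End AddFactor.

Lemma emode_act_add_charge k s n m (t : 'I_k -> nat) (P : {mpoly C[n]}) :
    (s + n <= m)%N -> emode_act s P (vac_ten R t) = 0 ->
  emode_act s P (vac_ten R (add_charge m t)) = 0.
Proof.
move=> snm Pt.
have -> : vac_ten R (add_charge m t) = add_vac m (vac_ten R t).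
  rewrite /add_vac /vac_ten fgliftU; congr (<< _ >>); apply/ffunP => j.
  by rewrite !ffunE /add_charge; case: unlift => //= j'; rewrite ffunE.
have PB := @poly_act_morph _ _ _ _ (fun i => emode_family k s i)
  (fun i => emode_family k.+1 s i) (add_vac m) P (vac_ten R t).
rewrite /emode_act -PB; first by rewrite -/(emode_act s P _) Pt linear0.
by move=> i v; apply: add_vac_emode_ten; have := ltn_ord i; lia.
Qed.

End Intertwiners.

(** * The relations hold on the vacuum vectors *)

Section SquareZero.
Variables (R : comNzRingType) (K : R -> Prop) (idK : ideal K).

Lemma exprD_sq (G Y : {poly R}) i :
  exists Q, (G + Y) ^+ i = G ^+ i + G ^+ i.-1 * Y *+ i + Y ^+ 2 * Q.
Proof.
elim: i => [|i [Q IH]]; first by exists 0; rewrite mulr0n mulr0 !addr0.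
exists (G ^+ i.-1 *+ i + (G + Y) * Q); rewrite exprS IH /=.
have GG : G * (G ^+ i.-1 * Y *+ i) = G ^+ i * Y *+ i.
  by case: i {IH} => [|i]; rewrite ?mulr0n ?mulr0// mulrnAr mulrA -exprS.
have -> : (G + Y) * (G ^+ i + G ^+ i.-1 * Y *+ i + Y ^+ 2 * Q) =
   G * G ^+ i + G * (G ^+ i.-1 * Y *+ i) + Y * G ^+ i + Y * (G ^+ i.-1 * Y *+ i) +
   (G + Y) * (Y ^+ 2 * Q) by ring.
by rewrite GG [G ^+ i.+1]exprS mulrS -!(mulr_natr (_ * Y)) -(mulr_natr (G ^+ i.-1)); ring.
Qed.

(** The sum of (i + 1 - a)_+ over the n entries a = N m + 1. *)
Definition order (n : nat) (N : nat -> nat) (i : nat) : nat := (\sum_(m < n) (i - N m))%N.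

Lemma low_coef_in_exp m P i : low_coef_in K m P -> low_coef_in K (m * i) (P ^+ i).
Proof.
move=> lP; elim: i => [|i IH]; first by rewrite muln0 => a.
by rewrite exprS mulnS; apply: low_coef_inM.
Qed.

(** A summand Y of square zero contributes at most once to each product of i
   summands, whereas G may be repeated.  The counts of the c j up to m, m < n,
   record the smallest total order of such a product, a repetition of G counting
   for n.  The squares vanish only below the degree B. *)
Lemma low_coef_in_sum_exp (I : Type) (r : seq I) (Y : I -> {poly R}) (c : I -> nat)
    (G : {poly R}) (n B i : nat) :
    low_coef_in K n G -> (forall j, low_coef_in K (c j) (Y j)) ->
    (forall j, low_coef_in K B (Y j ^+ 2)) ->
  low_coef_in K (minn B (order n (fun m => count (fun j => c j <= m)%N r) i))
    ((G + \sum_(j <- r) Y j) ^+ i).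
Proof.
move=> lG lY lY2; elim: r i => [|j r IH] i.
  rewrite big_nil addr0; apply: (low_coef_inW (m := n * i)).
    rewrite geq_min; apply/orP; right; rewrite /order /=.
    by rewrite sum_nat_const card_ord subn0.
  exact: low_coef_in_exp.
rewrite big_cons addrCA addrC.
have [Q ->] := exprD_sq (G + \sum_(j <- r) Y j) (Y j) i.
apply: low_coef_inD => //; last first.
  by apply: (low_coef_inW (geq_minl _ _)); rewrite mulrC; apply: low_coef_inMl.
apply: low_coef_inD => //.
  apply: low_coef_inW (IH i); rewrite leq_min geq_minl geq_min; apply/orP; right.
  by apply: leq_sum => m _ /=; lia.
case: i => [|i]; first by move=> a _; rewrite mulr0n coef0; apply: ideal0.
apply: low_coef_inMn => //=; apply: low_coef_inW (low_coef_inM idK (IH i) (lY j)).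
rewrite addn_minl leq_min geq_min leq_addr /= geq_min; apply/orP; right.
have : (\sum_(m < n) (m < c j)%N <= c j)%N.
  suff -> : (\sum_(m < n) (m < c j)%N = minn n (c j))%N by exact: geq_minr.
  by elim: (n) => [|n' IHn]; rewrite ?big_ord0 ?big_ord_recr /= ?IHn; lia.
rewrite addnC => cj; rewrite (leq_trans _ (leq_add cj (leqnn _)))//.
rewrite /order -big_split /= leq_sum// => m _.
by case: leqP; lia.
Qed.

End SquareZero.

Section OrderIdeal.
Variables (R : realType).
Local Notation C := R[i].

(** The ideal generated by the coefficients of z^b in e(z)^i, b < o i, as the
   intersection of the ideals which contain them. *)
Definition order_ideal n (o : nat -> nat) (P : {mpoly C[n]}) : Prop :=
  forall K : {mpoly C[n]} -> Prop, ideal K ->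
    (forall i, low_coef_in K (o i) (e_poly R n ^+ i)) -> K P.

Lemma order_ideal_ideal n o : ideal (@order_ideal n o).
Proof.
split=> [K idK _|P Q oP oQ K idK oK|P Q oQ K idK oK]; first exact: ideal0.
  by apply: idealD => //; [apply: oP | apply: oQ].
by apply: idealMl => //; apply: oQ.
Qed.

Lemma order_ideal_gen n o i : low_coef_in (@order_ideal n o) (o i) (e_poly R n ^+ i).
Proof. by move=> a ao K idK /(_ i a); apply. Qed.

(** The components of the modes e_s, ..., e_(s+B-1) on the k factors commute; they
   are the values of the variables y_(j,m) of a polynomial ring A. *)
Section Kills.
Variables (k s n B : nat) (t : 'I_k -> nat).
Local Notation I := ('I_k * 'I_B)%type.
Local Notation A := {mpoly C[#|{: I}|]}.

Definition factor_mode (x : 'I_#|{: I}|) : {linear Ften R k -> Ften R k} :=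
  at_factor (enum_val x).1 (@emode R (s + (enum_val x).2)).

Lemma factor_mode_comm x y w :
  factor_mode x (factor_mode y w) = factor_mode y (factor_mode x w).
Proof. exact: at_emode_comm. Qed.

Definition y_var (j : 'I_k) (m : 'I_B) : A := 'X_(enum_rank (j, m)).

Lemma y_varE j m w :
  poly_act factor_mode (y_var j m) w = at_factor j (@emode R (s + m)) w.
Proof. by rewrite /y_var poly_actX /factor_mode enum_rankK. Qed.

Definition y_poly j : {poly A} := \sum_(m < B) y_var j m *: 'X^m.

Lemma coef_y_poly j a : (y_poly j)`_a = if insub a is Some m then y_var j m else 0.
Proof.
rewrite /y_poly coef_sum; case: insubP => [m _ <-|aB].
  rewrite (bigD1 m)//= coefZ coefXn eqxx mulr1 big1 ?addr0// => m' mm'.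
  by rewrite coefZ coefXn eq_sym (inj_eq val_inj) (negbTE mm') mulr0.
rewrite big1// => m _; rewrite coefZ coefXn; case: eqP => [am|]; last by rewrite mulr0.
by rewrite am ltn_ord in aB.
Qed.

Definition kills (Q : A) : Prop := poly_act factor_mode Q (vac_ten R t) = 0.

Lemma kills_ideal : ideal kills.
Proof. exact: annihilator_ideal factor_mode_comm _. Qed.

Lemma kills_y_poly j : low_coef_in kills (t j - s) (y_poly j).
Proof.
move=> a ats; rewrite coef_y_poly; case: insubP => [m _ am|_]; last exact: ideal0 kills_ideal.
rewrite /kills y_varE at_factor_vac0// emode_vac0//; rewrite -am /= in ats; lia.
Qed.

(** In the vanishing coefficient of the square of the current the modes below s
   do not contribute, as they kill the vacuum. *)
Lemma emode_sq_vac m u : (s <= u)%N ->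
  \sum_(i < m.+1) emode (s + i) (emode (s + (m - i)) << vac_below u >>) = 0 :> F R.
Proof.
move=> su; have := emode_sq (s + m + s) (<< vac_below u >> : F R).
rewrite -(big_mkord xpredT (fun i => emode i (emode (s + m + s - i) << vac_below u >>))).
rewrite (@big_cat_nat _ _ _ s) //=; last by lia.
rewrite [X in X + _]big_nat big1 ?add0r => [|i /andP[_ i_s]]; last first.
  by rewrite emode_comm emode_vac0 ?linear0//; lia.
rewrite (@big_cat_nat _ _ _ (s + m).+1) /=; try lia.
rewrite [X in _ + X]big_nat [X in _ + X]big1 ?addr0 => [|i /andP[i_s i_m]]; last first.
  by rewrite emode_vac0 ?linear0//; lia.
rewrite -{1}[s]add0n big_addn -addnS addKn big_mkord => eq0; rewrite -[RHS]eq0.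
apply: eq_bigr => i _; congr (emode _ (emode _ _)); have := ltn_ord i; lia.
Qed.

Lemma kills_y_poly_sq j : (s <= t j)%N -> low_coef_in kills B (y_poly j ^+ 2).
Proof.
move=> st a aB; rewrite /kills expr2 coefM poly_act_sum.
rewrite -[RHS](linear0 (insert_at [ffun j => vac_below (t j)] j)).
rewrite -(emode_sq_vac a st) linear_sum; apply: eq_bigr => i _.
have ia : (i < B)%N by have := ltn_ord i; lia.
have aia : (a - i < B)%N by lia.
rewrite !coef_y_poly (insubT (fun i => i < B)%N ia) (insubT (fun i => i < B)%N aia) /=.
rewrite (poly_actM factor_mode_comm) !y_varE /= at_factor_comp at_factorU ffunE.
by rewrite /comp /=.
Qed.

(** Minus the modes e_m, m >= s + n, which e(z) lacks.  They are divisible by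
   z^n, and in the order a single factor counts for at most n. *)
Definition high_part : {poly A} :=
  - \sum_(m < B | ~~ (m < n)%N) (\sum_(j < k) y_var j m) *: 'X^m.

Lemma kills_high_part : low_coef_in kills n high_part.
Proof.
move=> a an; rewrite coefN coef_sum big1 ?oppr0 => [|m nm]; first exact: ideal0 kills_ideal.
rewrite coefZ coefXn; case: eqP => [am|]; last by rewrite mulr0.
by rewrite -am an in nm.
Qed.

Variable nB : (n <= B)%N.

Definition sum_modes : n.-tuple A :=
  [tuple \sum_(j < k) y_var j (widen_ord nB i) | i < n].

Lemma sum_modes_act (i : 'I_n) v :
  emode_family R k s i v = poly_act factor_mode (tnth sum_modes i) v.
Proof.
rewrite tnth_mktuple poly_act_sum; apply: eq_bigr => j _.
by rewrite y_varE.
Qed.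

Lemma e_poly_sum_modes :
  map_poly (comp_mpoly sum_modes) (e_poly R n) = high_part + \sum_(j < k) y_poly j.
Proof.
rewrite /y_poly exchange_big /= (bigID (fun m : 'I_B => m < n)%N) /= addrCA.
under [X in _ + (_ + X)]eq_bigr do rewrite -scaler_suml.
rewrite /high_part addNr addr0 raddf_sum /=.
rewrite (big_ord_narrow nB) /=; apply: eq_bigr => i _.
by rewrite map_polyZ /= map_polyXn comp_mpolyXU -tnth_nth tnth_mktuple scaler_suml.
Qed.

End Kills.

(** The numbers N_m which determine the order of a product of vacuums. *)
Definition n_charge (s k : nat) (t : 'I_k -> nat) (m : nat) : nat :=
  #|[pred j | (t j <= s + m)%N]|.

Theorem order_ideal_kills k s n (t : 'I_k -> nat) (P : {mpoly C[n]}) : (forall j, (s <= t j)%N) ->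
  order_ideal (order n (n_charge s t)) P -> emode_act s P (vac_ten R t) = 0 :> Ften R k.
Proof.
move=> st oP; apply: (oP (fun Q => emode_act s Q (vac_ten R t) = 0)).
  exact: (annihilator_ideal (@emode_family_comm R k s n)).
move=> i b bo; pose B := (n + b.+1)%N.
have nB : (n <= B)%N by exact: leq_addr.
rewrite /emode_act -(poly_act_comp (factor_mode_comm s (B := B)) _ _ (sum_modes_act s nB)).
have -> : (e_poly R n ^+ i)`_b \mPo sum_modes k nB =
    ((high_part k n B + \sum_(j < k) y_poly B j) ^+ i :
      {poly {mpoly C[#|{: 'I_k * 'I_B}|]}})`_b.
  have sumE := @e_poly_sum_modes k n B nB.
  by rewrite -sumE -(rmorphXn (map_poly (comp_mpoly (sum_modes k nB)))) /= coef_map.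
have idK : ideal (@kills k s B t) by exact: kills_ideal.
have lowG : low_coef_in (@kills k s B t) n (high_part k n B) by exact: kills_high_part.
have lowY j : low_coef_in (@kills k s B t) (t j - s) (y_poly B j) by exact: kills_y_poly.
have lowY2 j : low_coef_in (@kills k s B t) B (y_poly B j ^+ 2) by apply: kills_y_poly_sq.
have := @low_coef_in_sum_exp _ _ idK _ (index_enum 'I_k)
  (@y_poly k B) (fun j => t j - s)%N (high_part k n B) n B i lowG lowY lowY2.
move=> /(_ b) bK; apply: bK.
rewrite leq_min; apply/andP; split; first by rewrite /B addnS ltnS leq_addl.
apply: (leq_trans bo); apply: leq_sum => m _; apply: leq_sub2l.
rewrite /n_charge -sum1_card -sum1_count; apply/eq_leq/eq_bigl => j.
by rewrite inE leq_subLR.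
Qed.

End OrderIdeal.

(** * There are no other relations *)

Section Reduction.
Variable R : realType.
Local Notation C := R[i].

Lemma n_chargeE s k (t : 'I_k -> nat) m :
  n_charge s t m = (\sum_j (t j <= s + m)%N)%N.
Proof. by rewrite /n_charge -sum1_card [in RHS]big_mkcond [LHS]big_mkcond. Qed.

Lemma n_charge0 s k (t : 'I_k -> nat) : (forall j, (s <= t j)%N) ->
  n_charge s t 0 = #|[pred j | t j == s]|.
Proof. by move=> st; apply: eq_card => j; rewrite !inE addn0 eqn_leq st andbT. Qed.

Lemma leq_n_charge s k (t : 'I_k -> nat) m m' : (m <= m')%N ->
  (n_charge s t m <= n_charge s t m')%N.
Proof.
by move=> mm'; rewrite !n_chargeE; apply: leq_sum => j _; lia.
Qed.

Lemma n_charge_raise s k (t : 'I_k -> nat) m : (forall j, (s <= t j)%N) ->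
  (n_charge s.+1 (raise s t) m + (if m == 0 then n_charge s t 0 else 0) =
   n_charge s t m.+1)%N.
Proof.
move=> st; have -> : (if m == 0 then n_charge s t 0 else 0)%N =
    (\sum_j if m == 0 then (t j <= s + 0)%N : nat else 0)%N.
  by case: eqP => _; rewrite ?n_chargeE// big1.
rewrite !n_chargeE -big_split /=; apply: eq_bigr => j _; rewrite /raise.
have := st j; case: (eqVneq (t j) s) => [->|ts]; case: (eqVneq m 0) => [->|m0]; lia.
Qed.

Lemma n_charge_add s k (t : 'I_k -> nat) c m : (s + m < c)%N ->
  n_charge s (add_charge c t) m = n_charge s t m.
Proof.
move=> smc; rewrite !n_chargeE big_ord_recl /add_charge unlift_none /=.
rewrite leqNgt smc add0n; apply: eq_bigr => j _; by rewrite liftK.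
Qed.

Lemma n_charge_exchange s k (t : 'I_k -> nat) r1 r2 m : r1 != r2 ->
    t r1 = s -> (s + 2 <= t r2)%N ->
  (n_charge s (set_at (set_at t r1 s.+1) r2 (t r2).-1) m + (m == 0) =
   n_charge s t m + (s + m == (t r2).-1))%N.
Proof.
move=> r12 tr1 tr2; rewrite !n_chargeE (bigD1 r1) //= (bigD1 r2) 1?eq_sym//=.
rewrite [in RHS](bigD1 r1) //= [in RHS](bigD1 r2) 1?eq_sym//=.
rewrite /set_at eqxx (negbTE r12) eqxx.
rewrite (eq_bigr (fun j => (t j <= s + m)%N : nat)); last first.
  by move=> j /andP[jr1 jr2]; rewrite (negbTE jr1) (negbTE jr2).
lia.
Qed.

Lemma eq_order n N N' i : (forall m, (m < n)%N -> N m = N' m) ->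
  order n N i = order n N' i.
Proof. by move=> NN'; apply: eq_bigr => m _; rewrite NN'. Qed.

Lemma eq_order_ideal n o o' (P : {mpoly C[n]}) :
  o =1 o' -> order_ideal o P -> order_ideal o' P.
Proof.
by move=> eq_o oP K idK oK; apply: oP => // i a ai; apply: (oK i a); rewrite -eq_o.
Qed.

(** The exchange lowers N_0 by one and raises N_d by one, d = t_(r2) - 1 - s, so
   that o(i) grows by one exactly when N_0 <= i <= N_d.  By the choice of r2
   the N_m with 1 <= m <= d are equal, and then o(i) = i - N_0.  With a single
   variable o(i) = i - N_0 for all i. *)
Lemma order_exchange n s k (t : 'I_k -> nat) r1 r2 i b :
    r1 != r2 -> (forall j, (s <= t j)%N) -> t r1 = s -> (s + 2 <= t r2)%N ->
    (forall j, (s + 2 <= t j)%N -> (t r2 <= t j)%N) ->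
    (t r2 <= s + maxn n.+1 2)%N ->
    (b < order n.+1 (n_charge s (set_at (set_at t r1 s.+1) r2 (t r2).-1)) i)%N ->
  (b < order n.+1 (n_charge s t) i)%N \/ (b + n_charge s t 0 <= i)%N.
Proof.
move=> r12 st tr1 tr2 tr2_min tr2n; set t' := set_at _ _ _.
have N' m : (n_charge s t' m + (m == 0) = n_charge s t m + (s + m == (t r2).-1))%N.
  exact: n_charge_exchange.
pose d := ((t r2).-1 - s)%N.
have N1d : n_charge s t 1 = n_charge s t d.
  apply: eq_card => j; rewrite !inE; apply/idP/idP => [tj|tj]; first by rewrite /d; lia.
  by have := tr2_min j; rewrite /d in tj; lia.
have N'0 : (n_charge s t' 0).+1 = n_charge s t 0 by have := N' 0%N; rewrite eqxx; lia.
rewrite /order !big_ord_recl /=.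
set S := (\sum_(_ < n) _)%N; set S' := (\sum_(_ < n) _)%N.
have [iN1|N1i] := leqP i (n_charge s t 1).
  have -> : S = 0%N; last by lia.
  rewrite /S big1// => m _; rewrite /bump leq0n add1n.
  by have := leq_n_charge s t (isT : (1 <= m.+1)%N); have := N' m.+1; lia.
suff SS' : (n = 0)%N \/ (S.+1 = S')%N.
  case: SS' => [n0|<-]; last by lia.
  by have -> : S = 0%N; [rewrite /S n0 big_ord0 | lia].
have [->|n0] := eqVneq n 0%N; [by left | right].
have dn : (d.-1 < n)%N by rewrite /d; lia.
rewrite /S' (bigD1 (Ordinal dn)) //= /S (bigD1 (Ordinal dn)) //= -addSn.
rewrite /bump leq0n !add1n prednK; last by rewrite /d; lia.
congr (_ + _)%N; first by have := N' d; rewrite N1d in N1i; rewrite /d in N1i *; lia.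
apply: eq_bigr => m md; rewrite leq0n !add1n; congr (i - _)%N.
have := N' m.+1; have : (m : nat) != d.-1 by apply: contra md => /eqP md; apply/eqP/val_inj.
by rewrite /d; lia.
Qed.

(** In a product of i coefficients of total index b at least i - b of the indices
   are zero. *)
Lemma coef_exp_divisible (A : comNzRingType) (E : {poly A}) Z i b :
  (b + Z <= i)%N -> exists Q, (E ^+ i)`_b = Q * E`_0 ^+ Z.
Proof.
elim: i Z b => [|i IH] Z b bZ.
  have -> : Z = 0%N by lia.
  by exists (E ^+ 0)`_b; rewrite !expr0 mulr1.
case: Z bZ => [|Z] bZ; first by exists (E ^+ i.+1)`_b; rewrite expr0 mulr1.
rewrite exprS coefM; elim/big_ind: _ => [|x y [Qx ->] [Qy ->]|a _].
- by exists 0; rewrite mul0r.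
- by exists (Qx + Qy); rewrite mulrDl.
case: a => -[|a] ab /=.
  have [|Q ->] := IH Z (b - 0)%N; first by lia.
  by exists Q; rewrite exprS mulrCA.
have [|Q ->] := IH Z.+1 (b - a.+1)%N; first by lia.
by exists (E`_a.+1 * Q); rewrite mulrA.
Qed.

Lemma coef_e_poly n (i : 'I_n) : (e_poly R n)`_i = 'X_i.
Proof.
rewrite /e_poly coef_sum (bigD1 i)//= coefZ coefXn eqxx mulr1 big1 ?addr0// => j ji.
by rewrite coefZ coefXn eq_sym (inj_eq val_inj) (negbTE ji) mulr0.
Qed.

Definition tail_vars n : n.-tuple {mpoly C[n.+1]} :=
  [tuple 'X_(fintype.lift ord0 i) | i < n].

Lemma e_poly_tail n : e_poly R n.+1 =
  ('X_ord0)%:P + 'X * map_poly (comp_mpoly (tail_vars n)) (e_poly R n).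
Proof.
rewrite /e_poly big_ord_recl /= expr0 -mul_polyC mulr1; congr (_ + _).
rewrite raddf_sum mulr_sumr; apply: eq_bigr => i _ /=.
rewrite map_polyZ /= map_polyXn comp_mpolyXU -tnth_nth tnth_mktuple.
by rewrite -scalerAr -exprS.
Qed.

Lemma split_first_var n (P : {mpoly C[n.+1]}) :
  exists P0 P1, P = (P0 \mPo tail_vars n) + 'X_ord0 * P1.
Proof.
pose D (Q : {mpoly C[n.+1]}) := exists P0 P1, Q = (P0 \mPo tail_vars n) + 'X_ord0 * P1.
have DC c : D c%:MP by exists c%:MP, 0; rewrite comp_mpolyC mulr0 addr0.
have DD Q Q' : D Q -> D Q' -> D (Q + Q').
  move=> [Q0 [Q1 ->]] [Q0' [Q1' ->]]; exists (Q0 + Q0'), (Q1 + Q1').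
  by rewrite comp_mpolyD mulrDr addrACA.
have DM Q Q' : D Q -> D Q' -> D (Q * Q').
  move=> [Q0 [Q1 ->]] [Q0' [Q1' ->]].
  exists (Q0 * Q0'), (Q1 * ((Q0' \mPo tail_vars n) + 'X_ord0 * Q1') +
     (Q0 \mPo tail_vars n) * Q1').
  rewrite rmorphM /= mulrDl -mulrA [X in X + _ = _]mulrDr -addrA; congr (_ + _).
  by rewrite [in RHS]mulrDr addrC; congr (_ + _); rewrite mulrCA.
have DX i : D 'X_i.
  case: (unliftP ord0 i) => [j|] ->.
    by exists 'X_j, 0; rewrite comp_mpolyXU -tnth_nth tnth_mktuple mulr0 addr0.
  by exists 0, 1; rewrite comp_mpoly0 mulr1 add0r.
rewrite -/(D P) (mpolyE P).
elim/big_ind: _ => [||m _]; [by rewrite -mpolyC0 | exact: DD |].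
rewrite -mul_mpolyC; apply: (DM) => //; rewrite mpolyXE_id.
elim/big_ind: _ => [||i _]; [by rewrite -mpolyC1 | exact: DM |].
elim: (m i) => [|a IH]; first by rewrite expr0 -mpolyC1.
by rewrite exprS; apply: DM.
Qed.

Lemma order_ideal_divn n o m (P : {mpoly C[n]}) :
  order_ideal o (P *+ m.+1) -> order_ideal o P.
Proof.
move=> oP; suff -> : P = (m.+1%:R^-1)%:MP * (P *+ m.+1).
  exact: idealMl (@order_ideal_ideal R n o) _ _ oP.
rewrite mul_mpolyC -(scaler_nat _ P) scalerA mulVf ?scale1r//.
by rewrite pnatr_eq0.
Qed.

(** Let Z = N_0 and E = e(z).  The constant coefficient of E^Z is e_0^Z, and
   pow_coef_mul_in, for E^Z and E^i, puts the product of e_0^Z with the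
   coefficients of E^i below i + o'(i) into the ideal, o' being the order of the
   raised charges.  For i = 1 this applies to e_0.  As E is e_0 plus z times the
   shifted polynomial, the claim follows for the powers of the latter. *)
Lemma order_ideal_tail n s k (t : 'I_k -> nat) (P : {mpoly C[n]}) :
    (forall j, (s <= t j)%N) ->
    order_ideal (order n (n_charge s.+1 (raise s t))) P ->
  order_ideal (order n.+1 (n_charge s t)) ('X_ord0 ^+ n_charge s t 0 * (P \mPo tail_vars n))
  /\ order_ideal (order n.+1 (n_charge s t))
       ('X_ord0 ^+ n_charge s t 0 * 'X_ord0 : {mpoly C[n.+1]}).
Proof.
move=> st; set Z := n_charge s t 0; set o := order n.+1 _; set o' := order n _ => oP.
have idJ := @order_ideal_ideal R n.+1 o.
pose K (x : {mpoly C[n.+1]}) := order_ideal o ('X_ord0 ^+ Z * x).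
have idK : ideal K.
  split=> [|x y Kx Ky|a x Kx]; rewrite /K; first by rewrite mulr0; apply: ideal0 idJ.
    by rewrite mulrDr; apply: idealD idJ _ _ _ _.
  by rewrite mulrCA; apply: idealMl idJ _ _ _.
have E0 : e_poly R n.+1 != 0.
  apply/eqP => E0; have := coef_e_poly (ord0 : 'I_n.+1); rewrite E0 coef0.
  move/(congr1 (mcoeff U_(ord0))); rewrite mcoeff0 mcoeffXU eqxx => /eqP.
  by rewrite eq_sym oner_eq0.
have coefE0 : ((e_poly R n.+1) ^+ Z)`_0 = 'X_ord0 ^+ Z.
  by rewrite -!horner_coef0 horner_exp horner_coef0 (coef_e_poly ord0).
have lowK i : low_coef_in K (i + o' i) (e_poly R n.+1 ^+ i).
  move=> b bi; rewrite /K -coefE0.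
  (* Termwise, i + o' i is at most 2p + o (Z + i - p). *)
  have bound p : (p <= Z)%N -> (p <= i)%N -> (b < p + p + (o p + o (Z + i - p)))%N.
    move=> pZ pi; apply: (leq_trans bi).
    have : (o' i <= p + \sum_(m < n) (Z + i - p - n_charge s t m.+1))%N.
      case: n {o oP idJ K idK E0 coefE0 P} @o' bi => [|n] o' bi.
        by rewrite /o' /order big_ord0.
      rewrite /o' /order !big_ord_recl /= addnA leq_add//.
        by have := n_charge_raise 0 st; rewrite eqxx -/Z; lia.
      apply: leq_sum => m _; have := n_charge_raise m.+1 st; rewrite /bump leq0n add1n /=; lia.
    move=> o'i; rewrite {2}/o /order big_ord_recl /= -/Z.
    under eq_bigr do rewrite /bump leq0n add1n.
    by move: o'i; move: (\sum_(m < n) _)%N (o' i) (o p) => S oi op; lia.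
  have lowE := @order_ideal_gen R n.+1 o.
  have divJ := @order_ideal_divn n.+1 o.
  have [Zi|iZ] := leqP Z i.
    apply: (pow_coef_mul_in idJ divJ E0 lowE Zi) => p pZ.
    by rewrite add0n; apply: bound => //; apply: leq_trans Zi.
  rewrite mulrC; apply: (pow_coef_mul_in idJ divJ E0 lowE (ltnW iZ)) => p pi.
  by rewrite addn0 [(i + Z)%N]addnC; apply: bound => //; apply: leq_trans (ltnW iZ).
have KX : K 'X_ord0.
  by have := lowK 1%N 0%N isT; rewrite expr1 (coef_e_poly ord0).
split=> //; apply: (oP (fun Q => K (Q \mPo tail_vars n))).
  split=> [|x y Kx Ky|a x Kx]; first by rewrite comp_mpoly0; apply: ideal0 idK.
    by rewrite comp_mpolyD; apply: idealD idK _ _ _ _.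
  by rewrite rmorphM; apply: idealMl idK _ _ _.
move=> i b bo; pose E' := map_poly (comp_mpoly (tail_vars n)) (e_poly R n).
have -> : (e_poly R n ^+ i)`_b \mPo tail_vars n = (('X * E') ^+ i)`_(i + b).
  by rewrite exprMn coefXnM ltnNge leq_addr addKn /E' -rmorphXn /= coef_map.
have -> : ('X * E') ^+ i = e_poly R n.+1 ^+ i - (e_poly R n.+1 ^+ i - ('X * E') ^+ i).
  by rewrite opprB addrC subrK.
rewrite subrXX {2}e_poly_tail -/E' addrK coefB; apply: (idealB idK).
  by apply: lowK; rewrite ltn_add2l.
by rewrite coefCM; apply: idealMr idK _ _ _.
Qed.

Theorem emode_act_order_ideal n s k (t : 'I_k -> nat) (P : {mpoly C[n]}) :
    (forall j, (s <= t j)%N) -> emode_act s P (vac_ten R t) = 0 :> Ften R k ->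
  order_ideal (order n (n_charge s t)) P.
Proof.
elim: n s k t P => [|n IHn] s k t P st Pt.
  have [c Pc] : exists c, P = c%:MP by exists P@_0%MM; apply: nvar0_mpolyC.
  move: Pt; rewrite Pc -[c%:MP]mulr1 mul_mpolyC /emode_act poly_actZ poly_act1.
  move/eqP; rewrite scaler_eq0 (negbTE (vac_ten_neq0 _ _)) orbF => /eqP ->.
  by rewrite scale0r; apply: (ideal0 (@order_ideal_ideal R 0 _)).
have [Z] := ubnP (n_charge s t 0); elim: Z k t P st Pt => // Z IHZ k t P st Pt tZ.
pose c := (s + maxn n.+1 2)%N.
(* A factor v(c - 1), on which the modes act by zero, is appended; it makes
   sure that the exchange finds some t_j >= s + 2. *)
suff main k' (u : 'I_k' -> nat) r0 : (forall j, (s <= u j)%N) -> u r0 = c ->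
    emode_act s P (vac_ten R u) = 0 -> (n_charge s u 0 < Z.+1)%N ->
    order_ideal (order n.+1 (n_charge s u)) P.
  have tt m : (m < n.+1)%N -> n_charge s (add_charge c t) m = n_charge s t m.
    by move=> mn; apply: n_charge_add; rewrite /c; lia.
  apply: (@eq_order_ideal _ (order n.+1 (n_charge s (add_charge c t)))).
    by move=> i; apply: eq_order.
  apply: (main _ _ ord0); last by rewrite tt.
  - by move=> j; rewrite /add_charge; case: unlift => //=; rewrite /c; lia.
  - by rewrite /add_charge unlift_none.
  - by apply: emode_act_add_charge => //; rewrite /c; lia.
move=> {}st ur0 {}Pt {}tZ {t k}.
set o := order n.+1 _; have idJ := @order_ideal_ideal R n.+1 o.
(* The exchange; for Z = 0 there is nothing to do. *)
have [J [Q [oJ PE]]] : exists J Q, order_ideal o J /\ P = J + Q * 'X_ord0 ^+ n_charge s u 0.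
  have [u0|] := posnP (n_charge s u 0).
    by exists 0, P; rewrite u0 expr0 mulr1 add0r; split=> //; apply: ideal0 idJ.
  rewrite {1}n_charge0// => /card_gt0P[r1]; rewrite inE => /eqP ur1.
  have r0c : (s + 2 <= u r0)%N by rewrite ur0 /c; lia.
  have [r2 ur2 r2_min] := @arg_minnP _ r0 (fun r => s + 2 <= u r)%N u r0c.
  have r12 : r1 != r2 by apply/eqP => r12; rewrite -r12 ur1 in ur2; lia.
  pose u' := set_at (set_at u r1 s.+1) r2 (u r2).-1.
  have oP : order_ideal (order n.+1 (n_charge s u')) P.
    apply: IHZ.
    - move=> j; rewrite /u' /set_at; case: eqP => _; first by lia.
      by case: eqP => _ //; apply: st.
    - have ur12 : (u r1 + 2 <= u r2)%N by rewrite ur1.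
      by have := emode_act_exchange r12 ur12 Pt; rewrite ur1.
    - have := n_charge_exchange 0 r12 ur1 ur2; rewrite -/u' eqxx.
      have -> : (s + 0 == (u r2).-1) = false by lia.
      by lia.
  apply: (oP (fun P => exists J Q, order_ideal o J /\ P = J + Q * 'X_ord0 ^+ n_charge s u 0)).
    split=> [|x y [J [Q [oJ ->]]] [J' [Q' [oJ' ->]]]|a x [J [Q [oJ ->]]]].
    - by exists 0, 0; rewrite mul0r addr0; split=> //; apply: ideal0 idJ.
    - by exists (J + J'), (Q + Q'); split; [apply: idealD idJ _ _ _ _ | rewrite mulrDl addrACA].
    - by exists (a * J), (a * Q); split; [apply: idealMl idJ _ _ _ | rewrite mulrDr mulrA].
  have ur2n : (u r2 <= s + maxn n.+1 2)%N by rewrite -/c -ur0; apply: r2_min.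
  move=> i b bo; have := order_exchange r12 st ur1 ur2 r2_min ur2n bo.
  case=> [{}bo|/coef_exp_divisible bZ].
    by exists ((e_poly R n.+1 ^+ i)`_b), 0; rewrite mul0r addr0; split=> //; apply: order_ideal_gen.
  have [Q ->] := bZ _ (e_poly R n.+1); rewrite (coef_e_poly ord0).
  by exists 0, Q; rewrite add0r; split=> //; apply: ideal0 idJ.
have Qu : emode_act s Q (vac_ten R (raise s u)) = 0.
  have comm := @emode_family_comm R k' s n.+1.
  move: Pt; rewrite PE /emode_act poly_actD -/(emode_act s J _) order_ideal_kills// add0r.
  rewrite (poly_actM comm) (poly_act_exp comm).
  rewrite (eq_iter (f' := @emode_ten R k' s)); last first.
    by move=> v; rewrite poly_actX /emode_family /= addn0.
  have itE := iter_emode_ten_vac R st; rewrite -(n_charge0 st) in itE.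
  rewrite itE poly_actZr => /eqP.
  rewrite scaler_eq0 mulrn_eq0 signr_eq0 orbF.
  by rewrite eqn0Ngt fact_gt0 /= => /eqP.
(* The mode e_s kills the raised vacuums, so only the part Q0 of Q acts. *)
have [Q0 [Q1 QE]] := split_first_var Q.
have ru j : (s.+1 <= raise s u j)%N.
  by rewrite /raise; have := st j; case: eqP; lia.
have oQ0 : order_ideal (order n (n_charge s.+1 (raise s u))) Q0.
  apply: IHn => //; move: Qu; rewrite QE /emode_act poly_actD mulrC.
  have comm := @emode_family_comm R k' s n.+1.
  rewrite (poly_actM comm) poly_actX /emode_family /= addn0 emode_ten_vac; last first.
    by move=> j; apply: ltnW.
  rewrite big1 => [|j /eqP rj]; last by have := ru j; lia.
  rewrite poly_act0r addr0.
  move=> Q0u; rewrite -[RHS]Q0u; symmetry; apply: (poly_act_comp comm) => i v.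
  by rewrite tnth_mktuple poly_actX /emode_family lift0 addSnnS.
have [oX oX0] := order_ideal_tail st oQ0.
rewrite PE QE mulrDl; apply: (idealD idJ oJ); apply: (idealD idJ).
  by rewrite mulrC.
by rewrite mulrAC; apply: (idealMr idJ); rewrite mulrC.
Qed.

End Reduction.

(** * Multiplicities and orders *)

Section Counting.

Lemma sum_downset (p : pred nat) i M : (i <= M)%N ->
    (forall a b, (a <= b)%N -> p b -> p a) ->
  (\sum_(a < i) p a = minn i (\sum_(a < M) p a))%N.
Proof.
move=> iM p_down; have le_id j : (\sum_(a < j) p a <= j)%N.
  by rewrite -[leqRHS]card_ord -sum1_card leq_sum// => a _; apply: leq_b1.
elim: M iM => [|M IH]; first by rewrite leqn0 => /eqP ->; rewrite !big_ord0.
rewrite leq_eqVlt => /orP[/eqP ->|iM]; first by rewrite (minn_idPr (le_id _)).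
rewrite ltnS in iM; rewrite big_ord_recr /=; have [pM|pM] := boolP (p M); last first.
  by rewrite addn0; apply: IH.
have full j : (j <= M)%N -> (\sum_(a < j) p a = j)%N.
  move=> jM; rewrite -[RHS]card_ord -sum1_card; apply: eq_bigr => a _.
  by rewrite (p_down a M) // ltnW// (leq_trans _ jM).
by rewrite !full//; lia.
Qed.

Variables (n k : nat) (A : n.-tuple nat).
Hypothesis A_pos : all (fun a => 0 < a)%N A.

Lemma partial_multS j : partial_mult A j.+1 = (partial_mult A j + mult A j.+1)%N.
Proof. by rewrite /partial_mult big_nat_recr. Qed.

Lemma partial_mult0 : partial_mult A 0 = 0%N.
Proof. by rewrite /partial_mult big_geq. Qed.

Lemma partial_mult_count j : partial_mult A j = count (fun a => a <= j)%N A.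
Proof.
elim: j => [|j IH].
  rewrite partial_mult0; apply/esym/eqP; rewrite -leqn0 leqNgt -has_count.
  by apply/hasPn => a /(allP A_pos); rewrite lt0n leqn0.
rewrite partial_multS IH /mult -count_predUI addnC.
rewrite (eq_count (a2 := pred0)) ?count_pred0 ?add0n.
  by apply: eq_count => a /=; lia.
by move=> a /=; lia.
Qed.

Lemma leq_partial_mult i j : (i <= j)%N -> (partial_mult A i <= partial_mult A j)%N.
Proof.
by move=> ij; rewrite !partial_mult_count; apply: sub_count => a /= /leq_trans; apply.
Qed.

Lemma partial_mult_size j : (partial_mult A j <= n)%N.
Proof. by rewrite partial_mult_count -[leqRHS](size_tuple A) count_size. Qed.

Lemma vanishing_order_partial i :
  vanishing_order A i = (\sum_(a < i) partial_mult A a.+1)%N.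
Proof.
rewrite /vanishing_order -(big_tuple _ _ A xpredT (fun a => (i.+1 - a)%N)).
transitivity (\sum_(x <- A) \sum_(a < i) (x <= a.+1))%N.
  apply: eq_big_seq => x /(allP A_pos) x0; elim: i => [|i IH].
    by rewrite big_ord0; lia.
  by rewrite big_ord_recr /= -IH; lia.
rewrite exchange_big; apply: eq_bigr => a _.
by rewrite partial_mult_count -sum1_count [RHS]big_mkcond.
Qed.

(** Both sides count the pairs (m, a) with a < i and m below the number of entries
   of A up to a + 1; this number is nondecreasing in a, which makes the a with a
   given m a final segment. *)
Lemma order_vanishing (N : nat -> nat) i :
    (forall j, (k < j)%N -> partial_mult A j = n) ->
    (forall m, (m < n)%N -> N m = \sum_(a < k) (partial_mult A a.+1 <= m))%N ->
  order n N i = vanishing_order A i.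
Proof.
move=> full NE; rewrite vanishing_order_partial /order.
transitivity (\sum_(m < n) \sum_(a < i) (m < partial_mult A a.+1))%N; last first.
  rewrite exchange_big; apply: eq_bigr => a _.
  have := partial_mult_size a.+1; move: (partial_mult _ _) => d; elim: n => [|n' IH] dn.
    by rewrite big_ord0; lia.
  rewrite big_ord_recr /=; move: dn; rewrite leq_eqVlt => /orP[/eqP ->|dn].
    rewrite ltnSn (eq_bigr (fun=> 1%N)); last by move=> m _; rewrite ltnW ?ltnS.
    by rewrite sum1_card card_ord addn1.
  by rewrite IH //; lia.
apply: eq_bigr => m _; rewrite NE//.
have p_down a b : (a <= b)%N -> (partial_mult A b.+1 <= m)%N -> (partial_mult A a.+1 <= m)%N.
  by move=> ab; apply/leq_trans/leq_partial_mult.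
have Nmax : (\sum_(a < k) (partial_mult A a.+1 <= m) =
    \sum_(a < maxn i k) (partial_mult A a.+1 <= m))%N.
  rewrite (big_ord_widen (maxn i k) (fun a => (partial_mult A a.+1 <= m)%N : nat)) ?leq_maxr//.
  rewrite big_mkcond; apply: eq_bigr => a _; case: ltnP => // ka.
  by rewrite full ?ltnS// leqNgt ltn_ord.
have := @sum_downset (fun a => partial_mult A a.+1 <= m)%N i (maxn i k) (leq_maxl _ _) p_down.
rewrite -Nmax => /= minE.
have : (\sum_(a < i) (partial_mult A a.+1 <= m) + \sum_(a < i) (m < partial_mult A a.+1) = i)%N.
  rewrite -big_split /= -[RHS]card_ord -sum1_card; apply: eq_bigr => a _; lia.
rewrite minE; move: (\sum_(a < k) _)%N (\sum_(a < i) _)%N => x y; lia.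
Qed.

End Counting.

(** * The presentation of a submodule generated by vacuums *)

Section Presentation.
Variable R : realType.
Local Notation C := R[i].

Lemma in_J_order_ideal n (A : n.-tuple nat) (P : {mpoly C[n]}) :
  all (fun a => 0 < a)%N A -> P \in @J R _ A <-> order_ideal (vanishing_order A) P.
Proof.
move=> A_pos; split=> [/asboolP[s sJ ->] K idK oK|oP].
  rewrite big_seq; apply: ideal_sum => // x xs; apply: idealMl => //.
  have /andP[_ x2] : J_index A x.2 by apply: (allP sJ); apply: map_f.
  exact: oK.
apply: (oP (fun P => P \in @J R _ A)).
  have [J0 _ JD] := @J_idealr_closed R n A; split=> // [x y Jx Jy|a x Jx].
    by have := JD 1 x y Jx Jy; rewrite mul1r.
  by have := JD a x 0 Jx J0; rewrite addr0.
move=> i b bi; apply/asboolP; exists [:: (1, (i, b))]; last by rewrite big_seq1 mul1r.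
rewrite /= /J_index /= bi !andbT lt0n; apply: contraTneq bi => ->.
by rewrite vanishing_order_partial// big_ord0.
Qed.

Lemma act_shiftE s n k (P : {mpoly C[n - s]}) (w : Ften R k) : filled_ten w ->
  act (shift P) w = emode_act s P w.
Proof.
move=> fw; pose T (i : 'I_n) := emode_family R k 0 i.
transitivity (poly_act (fun i => T i) (shift P) w).
  apply: (eq_poly_act_in (S := @filled_ten R k)) => // i v fv.
  by split; [exact: e_ten_emode | exact: filled_emode_ten].
apply: (poly_act_comp (@emode_family_comm R k 0 n)) => i v.
by rewrite tnth_mktuple poly_actX /emode_family /= add0n addnC.
Qed.

Lemma W_class_eq n (A : n.-tuple nat) (P Q : {mpoly C[n]}) :
  W_class R A P = W_class R A Q <-> P - Q \in @J R _ A.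
Proof. by rewrite Quotient.idealrBE; split=> [/eqP|/eqP]. Qed.

(** The vectors act (shift P) u and the classes of P are the values of two linear
   maps in P, which have the same kernel. *)
Lemma submod_presentation s n k (A' : (n - s).-tuple nat) (t : 'I_k -> nat)
    (c : C) (u : Ften R k) :
    all (fun a => 0 < a)%N A' -> c != 0 -> u = c *: vac_ten R t ->
    (forall j, (s <= t j)%N) ->
    (forall i, order (n - s) (n_charge s t) i = vanishing_order A' i) ->
  exists f : {linear submod s n u -> W R A'},
    [/\ bijective f, f (gen_submod s n u) = 1 &
      forall P : {mpoly C[n - s]}, f (act_submod s n u P) = W_class R A' P].
Proof.
move=> A'_pos c0 uE st oE.
have fu : filled_ten u by rewrite uE; apply/filled_tenZ/filled_vac_ten.
have act0 P : act (shift P) u = 0 <-> P \in @J R _ A'.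
  rewrite act_shiftE// uE /emode_act poly_actZr in_J_order_ideal//; split=> [/eqP|oP].
    rewrite scaler_eq0 (negbTE c0) => /eqP Pt.
    exact: (eq_order_ideal oE (emode_act_order_ideal st Pt)).
  rewrite [X in _ *: X](order_ideal_kills st) ?scaler0//.
  by apply: eq_order_ideal oP => i; rewrite oE.
have exP (w : submod s n u) : exists P : {mpoly C[n - s]}, submod_val w = act (shift P) u.
  exact: asboolW (valP w).
pose rep (w : submod s n u) : {mpoly C[n - s]} := projT1 (cid (exP w)).
have repP w : act_submod s n u (rep w) = w.
  by apply: val_inj; rewrite /= -(projT2 (cid (exP w))).
have actP a P Q : act_submod s n u (a *: P + Q) = a *: act_submod s n u P + act_submod s n u Q.
  by apply: val_inj; rewrite /= /shift comp_mpolyD comp_mpolyZ act_is_linear.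
have act_eq P Q : W_class R A' P = W_class R A' Q <-> act_submod s n u P = act_submod s n u Q.
  rewrite W_class_eq -act0.
  have -> : P - Q = - 1 *: Q + P by rewrite scaleN1r addrC.
  have := congr1 val (actP (-1) Q P) => /= ->; rewrite scaleN1r addrC.
  split=> [/subr0_eq PQ|PQ]; first exact: val_inj.
  have valPQ : submod_val (act_submod s n u P) = submod_val (act_submod s n u Q).
    by rewrite PQ.
  by apply/eqP; rewrite subr_eq0; apply/eqP; exact: valPQ.
pose f w := W_class R A' (rep w).
have fE P : f (act_submod s n u P) = W_class R A' P by apply/act_eq/repP.
have f_linear : linear f.
  move=> a v w; rewrite -{1}[v]repP -{1}[w]repP -actP fE rmorphD /= /f.
  by rewrite -mul_mpolyC rmorphM.
pose fL := HB.pack f (GRing.isLinear.Build C _ _ _ f f_linear) : {linear submod s n u -> W R A'}.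
exists fL; split=> //=.
  exists (fun w : W R A' => act_submod s n u (repr w)) => w.
    rewrite -[RHS]repP; apply/act_eq; rewrite -/(f w).
    exact: reprK.
  by rewrite /fL /= fE; exact: reprK.
have -> : gen_submod s n u = act_submod s n u 1.
  apply: val_inj; rewrite /= act_shiftE// /emode_act; exact/esym/poly_act1.
by rewrite fE rmorph1.
Qed.

End Presentation.

(** * The vector u *)

Section Vectors.
Variables (R : realType) (n k : nat) (A : n.-tuple nat).

(** The numbers t_j such that u is a multiple of the product of the v(t_j - 1). *)
Definition charges (l : nat) (j : 'I_k) : nat :=
  if (j.+1 < l)%N then (partial_mult A j.+1).+2 else partial_mult A j.+1.

Lemma u_A_vac l : exists2 c : R[i], c != 0 & u_A R A k l = c *: vac_ten R (charges l).
Proof.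
pose c (j : 'I_k) : R[i] := if (j.+1 < l)%N then (-1) ^+ partial_mult A j.+1 else 1.
exists (\prod_j c j).
  by apply/prodf_neq0 => j _; rewrite /c; case: ifP => _; rewrite ?signr_eq0 ?oner_eq0.
have vE : v_A R A k = vac_ten R (fun j : 'I_k => partial_mult A j.+1).
  have := tensor_scale (fun=> 1 : R[i]) [ffun j : 'I_k => vac_below (partial_mult A j.+1)].
  rewrite prodr_const expr1n scale1r /vac_ten => <-; congr tensor.
  apply: functional_extensionality_dep => j.
  by rewrite ffunE scale1r.
rewrite /u_A vE tensor_opU -tensor_scale; congr tensor.
apply: functional_extensionality_dep => j; rewrite !ffunE /c /charges.
case: ifP => _; last by rewrite scale1r.
by rewrite e_emode ?emode_vac//; apply: filled_vac.
Qed.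

Hypotheses (A_pos : all (fun a => 0 < a)%N A) (A_sorted : sorted leq A)
  (A_last : last 0%N A = k.+1).

Lemma leq_last a : a \in (A : seq nat) -> (a <= k.+1)%N.
Proof.
move=> aA; rewrite -A_last -nth_last -(nth_index 0%N aA).
have ia : (index a A < size A)%N by rewrite index_mem.
by apply: (sorted_leq_nth leq_trans leqnn) => //; rewrite ?inE; lia.
Qed.

Lemma partial_mult_full j : (k < j)%N -> partial_mult A j = n.
Proof.
move=> kj; rewrite partial_mult_count// -[RHS](size_tuple A); apply/eqP.
rewrite -all_count; apply/allP => a /leq_last ak; exact: leq_trans ak kj.
Qed.

Lemma mult_gt0 a : (0 < mult A a)%N -> (0 < a <= k.+1)%N.
Proof.
rewrite /mult -has_count => /hasP[b bA /= /eqP <-].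
by rewrite leq_last// andbT; apply: (allP A_pos).
Qed.

Lemma mult_partial a : (0 < a)%N -> partial_mult A a = (partial_mult A a.-1 + mult A a)%N.
Proof. by case: a => // a _; rewrite partial_multS. Qed.

(** The t_j are the partial sums of the multiplicities of A', raised by 2. *)
Lemma presentation_double (l : nat) (A' : (n - 2).-tuple nat) :
    (2 <= mult A l)%N -> all (fun a => 0 < a)%N A' ->
    mult A' l = (mult A l - 2)%N -> (forall i, i <> l -> mult A' i = mult A i) ->
  exists f : {linear submod 2 n (u_A R A k l) -> W R A'},
    [/\ bijective f, f (gen_submod 2 n (u_A R A k l)) = 1 &
      forall P : {mpoly R[i][n - 2]},
        f (act_submod 2 n (u_A R A k l) P) = W_class R A' P].
Proof.
move=> l2 A'_pos A'l A'E.
have [l0 lk] : (0 < l)%N /\ (l <= k.+1)%N by apply/andP/mult_gt0; lia.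
have D'E j : (partial_mult A' j + (if l <= j then 2 else 0) = partial_mult A j)%N.
  elim: j => [|j IH]; first by rewrite !partial_mult0; case: leqP => //; lia.
  rewrite !partial_multS; have [lj|lj] := eqVneq l j.+1.
    by rewrite -lj A'l in IH *; rewrite leqnn; move: IH; case: leqP; lia.
  rewrite A'E; last by move=> jl; rewrite jl eqxx in lj.
  have -> : (l <= j.+1)%N = (l <= j)%N by lia.
  by rewrite -IH addnAC.
have [c c0 uE] := u_A_vac l.
have chE (j : 'I_k) : charges l j = (2 + partial_mult A' j.+1)%N.
  by rewrite /charges -D'E; case: leqP; lia.
apply: (submod_presentation A'_pos c0 uE) => [j|i]; first by rewrite chE leq_addr.
apply: (@order_vanishing _ k) => // [j kj|m _].
  by have := D'E j; rewrite partial_mult_full// (leq_trans lk kj); lia.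
by rewrite n_chargeE; apply: eq_bigr => j _; rewrite chE leq_add2l.
Qed.

(** The t_j - 1 are, up to the order of the factors, the partial sums of the
   multiplicities of A': for j < l1 the partial sums of A are l - 1 zeros and l1 - l
   ones, which give l - 1 times t_j = 2 and l1 - l times t_j = 1. *)
Lemma presentation_single (l l1 : nat) (A' : (n - 1).-tuple nat) :
    mult A l = 1%N -> (forall m, mult A m <> 0%N -> (l <= m)%N) ->
    (l < l1)%N -> mult A l1 <> 0%N ->
    (forall m, (l < m)%N -> mult A m <> 0%N -> (l1 <= m)%N) ->
    all (fun a => 0 < a)%N A' ->
    (forall i, mult A' i + (i == l) + (i == l1) = mult A i + (i == l1 - l + 1))%N ->
  exists f : {linear submod 1 n (u_A R A k l) -> W R A'},
    [/\ bijective f, f (gen_submod 1 n (u_A R A k l)) = 1 &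
      forall P : {mpoly R[i][n - 1]},
        f (act_submod 1 n (u_A R A k l) P) = W_class R A' P].
Proof.
move=> Al l_min ll1 Al1 l1_min A'_pos A'E.
have [l0 lk] : (0 < l)%N /\ (l <= k.+1)%N by apply/andP/mult_gt0; lia.
have [_ l1k] : (0 < l1)%N /\ (l1 <= k.+1)%N by apply/andP/mult_gt0; lia.
have D'E j : (partial_mult A' j + (l <= j) + (l1 <= j) =
    partial_mult A j + (l1 - l + 1 <= j))%N.
  elim: j => [|j IH]; first by rewrite !partial_mult0; lia.
  by rewrite !partial_multS; have := A'E j.+1; lia.
have Dlow j : (j < l)%N -> partial_mult A j = 0%N.
  elim: j => [|j IH] jl; first exact: partial_mult0.
  rewrite partial_multS IH; last by lia.
  by have [//|/eqP/l_min] := eqVneq (mult A j.+1) 0%N; lia.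
have Dmid j : (l <= j < l1)%N -> partial_mult A j = 1%N.
  elim: j => [|j IH] jl; first by lia.
  rewrite partial_multS; have [lj|lj] := eqVneq l j.+1.
    by rewrite -lj Al Dlow//; lia.
  rewrite IH; last by lia.
  by have [->//|/eqP/l1_min] := eqVneq (mult A j.+1) 0%N; lia.
have Dhigh j : (l1 <= j)%N -> (2 <= partial_mult A j)%N.
  move=> l1j; apply: leq_trans (leq_partial_mult A_pos l1j).
  by rewrite mult_partial; [rewrite Dmid; lia | lia].
have [c c0 uE] := u_A_vac l.
apply: (submod_presentation A'_pos c0 uE) => [j|i].
  rewrite /charges; case: (leqP l j.+1) => // lj; have [jl1|l1j] := ltnP j.+1 l1.
    by rewrite Dmid// lj.
  exact: ltnW (Dhigh _ l1j).
apply: (@order_vanishing _ k) => // [j kj|m _].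
  by have := D'E j; rewrite partial_mult_full//; lia.
rewrite n_chargeE -(big_mkord xpredT (fun j => ((if (j.+1 < l)%N then
  (partial_mult A j.+1).+2 else partial_mult A j.+1) <= 1 + m)%N : nat)).
rewrite -(big_mkord xpredT (fun a => (partial_mult A' a.+1 <= m)%N : nat)).
rewrite !(@big_cat_nat _ _ _ l1.-1 0 k) //=; try lia; congr (_ + _)%N; last first.
  apply: eq_big_nat => j /andP[l1j jk]; have := D'E j.+1; have := Dhigh j.+1.
  by case: (leqP l j.+1); lia.
have low j : (j < l1.-1)%N ->
    (partial_mult A j.+1 = (l <= j.+1)%N) /\ (partial_mult A' j.+1 = (l1 - l + 1 <= j.+1))%N.
  move=> jl1; have := D'E j.+1; have [lj|jl] := leqP l j.+1.
    by rewrite Dmid; lia.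
  by rewrite Dlow; lia.
rewrite !big_mkord; have [m0|m0] := posnP m; last first.
  apply: eq_bigr => j _; have [-> ->] := low j (ltn_ord j).
  by case: (leqP l j.+1); lia.
transitivity (\sum_(j < l1.-1) (l.-1 <= j)%N)%N.
  apply: eq_bigr => j _; have [-> _] := low j (ltn_ord j).
  by case: (leqP l j.+1); lia.
transitivity (\sum_(j < l1.-1) (j < l1 - l)%N)%N; last first.
  by apply: eq_bigr => j _; have [_ ->] := low j (ltn_ord j); lia.
rewrite (reindex_inj rev_ord_inj); apply: eq_bigr => j _ /=; have := ltn_ord j; lia.
Qed.

End Vectors.

Theorem mainTheorem3 (R : realType) (n k : nat) (A : n.-tuple nat)
    (A_pos : all (fun a => 0 < a)%N A)
    (A_sorted : sorted leq A)
    (A_last : last 0%N A = k.+1) :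
  (forall (l : nat) (A' : (n - 2).-tuple nat),
     (2 <= mult A l)%N ->
     all (fun a => 0 < a)%N A' ->
     mult A' l = (mult A l - 2)%N ->
     (forall i, i <> l -> mult A' i = mult A i) ->
     exists f : {linear submod 2 n (u_A R A k l) -> W R A'},
       [/\ bijective f,
           f (gen_submod 2 n (u_A R A k l)) = 1 &
           forall P : {mpoly R[i][n - 2]},
             f (act_submod 2 n (u_A R A k l) P) = W_class R A' P])
  /\
  (forall (l l1 : nat) (A' : (n - 1).-tuple nat),
     mult A l = 1%N ->
     (forall m, mult A m <> 0%N -> (l <= m)%N) ->
     l <> k.+1 ->
     (l < l1)%N -> mult A l1 <> 0%N ->
     (forall m, (l < m)%N -> mult A m <> 0%N -> (l1 <= m)%N) ->
     all (fun a => 0 < a)%N A' ->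
     (forall i, mult A' i + (i == l) + (i == l1) =
                mult A i + (i == l1 - l + 1))%N ->
     exists f : {linear submod 1 n (u_A R A k l) -> W R A'},
       [/\ bijective f,
           f (gen_submod 1 n (u_A R A k l)) = 1 &
           forall P : {mpoly R[i][n - 1]},
             f (act_submod 1 n (u_A R A k l) P) = W_class R A' P]).
Proof.
split=> [l A' l2 A'_pos A'l A'E|l l1 A' Al l_min _ ll1 Al1 l1_min A'_pos A'E].
  exact: presentation_double.
exact: (@presentation_single R n k A A_pos A_sorted A_last l l1 A').
Qed.
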